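(* Let $\mathcal{C}$ be a modular tensor category, and let $T:\mathcal C^2_\pm\to\mathcal C$ and $R:\mathcal C\to\mathcal C^2_\pm$ be the functors $T(\oplus_iV_i\times W_i)=\oplus_iV_i\otimes W_i$ and $R(A)=\oplus_{i\in\mathcal I}(A\otimes U_i^\vee)\times U_i$. Then $\langle T,R,\hat\chi\rangle$ and $\langle R,T,\check\chi^{-1}\rangle$ are adjunctions, i.e. $R$ is both left and right adjoint of $T$. That is, the maps $$\hat\chi:\mathrm{Hom}_{\mathcal C}(T(M),A)\to\mathrm{Hom}_{\mathcal C^2_\pm}(M,R(A)),\qquad\check\chi:\mathrm{Hom}_{\mathcal C}(A,T(M))\to\mathrm{Hom}_{\mathcal C^2_\pm}(R(A),M)$$ defined in the context are bijections, natural in $A\in\mathcal C$ and $M\in\mathcal C^2_\pm$.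
   Context: A modular tensor category is an abelian semisimple finite $\mathbb{C}$-linear ribbon category with simple tensor unit $\mathbf 1$, braiding $c$ and twist $\theta$, such that, for representatives $\{U_i\}_{i\in\mathcal I}$ of the isomorphism classes of simple objects, the matrix $s_{i,j}=\mathrm{tr}(c_{U_j,U_i}\circ c_{U_i,U_j})$ is invertible. Associators and unit isomorphisms are suppressed. Dualities: $d_U:U^\vee\otimes U\to\mathbf 1$, $b_U:\mathbf 1\to U\otimes U^\vee$, $\tilde d_U:U\otimes U^\vee\to\mathbf 1$, $\tilde b_U:\mathbf 1\to U^\vee\otimes U$; $\dim U=d_U\circ\tilde b_U$; $\mathrm{Dim}\,\mathcal C=\sum_i(\dim U_i)^2$. $\mathcal C_+=\mathcal C$; $\mathcal C_-$ is $\mathcal C$ with inverse braiding and twist; $\mathcal C^2_\pm=\mathcal C_+\boxtimes\mathcal C_-$ has objects finite direct sums of pairs $V\times W$, with $\mathrm{Hom}(V\times W,V'\times W')=\mathrm{Hom}_{\mathcal C}(V,V')\otimes_{\mathbb C}\mathrm{Hom}_{\mathcal C}(W,W')$ and componentwise tensor product. $T$ acts on morphisms by $f\times g\mapsto f\otimes g$, and $R(f)=\oplus_i(f\otimes\mathrm{id}_{U_i^\vee})\times\mathrm{id}_{U_i}$. For $V\in\mathcal C$ choose a basis $\{b_V^{(i;\alpha)}\}_\alpha$ of $\mathrm{Hom}(V,U_i)$ and the dual basis $\{b^V_{(i;\alpha)}\}_\alpha$ of $\mathrm{Hom}(U_i,V)$, $b_V^{(i;\alpha)}\circ b^V_{(i;\beta)}=\delta_{\alpha\beta}\mathrm{id}_{U_i}$.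 Writing $M=\oplus_{n}M_n^l\times M_n^r$, the maps (independent of the choice of bases) are: for $f=\oplus_nf_n$ with $f_n:M_n^l\otimes M_n^r\to A$, $$\hat\chi(f)=\bigoplus_{n,i}\sum_\alpha\big[(f_n\otimes\mathrm{id}_{U_i^\vee})\circ(\mathrm{id}_{M_n^l}\otimes b^{M_n^r}_{(i;\alpha)}\otimes\mathrm{id}_{U_i^\vee})\circ(\mathrm{id}_{M_n^l}\otimes b_{U_i})\big]\times b_{M_n^r}^{(i;\alpha)},$$ and for $g=\oplus_ng_n$ with $g_n:A\to M_n^l\otimes M_n^r$, $$\check\chi(g)=\bigoplus_{n,i}\sum_\alpha\frac{\mathrm{Dim}\,\mathcal C}{\dim U_i}\big[(\mathrm{id}_{M_n^l}\otimes\tilde d_{U_i})\circ(\mathrm{id}_{M_n^l}\otimes b_{M_n^r}^{(i;\alpha)}\otimes\mathrm{id}_{U_i^\vee})\circ(g_n\otimes\mathrm{id}_{U_i^\vee})\big]\times b^{M_n^r}_{(i;\alpha)}.$$ An adjunction $\langle F,G,\chi\rangle$ from $\mathcal C_1$ to $\mathcal C_2$ consists of functors $F:\mathcal C_1\to\mathcal C_2$, $G:\mathcal C_2\to\mathcal C_1$ and bijections $\chi:\mathrm{Hom}_{\mathcal C_2}(F(A_1),A_2)\to\mathrm{Hom}_{\mathcal C_1}(A_1,G(A_2))$ natural in $A_1,A_2$; then $F$ is left adjoint of $G$. *)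

(* Defs.v *)
From HB Require Import structures.
From mathcomp Require Import all_boot all_order all_algebra.
From mathcomp Require Import boolp reals complex.

Set Implicit Arguments.
Unset Strict Implicit.
Unset Printing Implicit Defensive.

Import GRing.Theory.
Local Open Scope ring_scope.

Declare Scope cat_scope.
Delimit Scope cat_scope with cat.
Local Open Scope cat_scope.

Record category := Category {
  cat_obj :> Type;
  mor : cat_obj -> cat_obj -> Type;
  cat_id : forall X, mor X X;
  cat_comp : forall X Y Z, mor Y Z -> mor X Y -> mor X Z;
  cat_comp1m : forall X Y (f : mor X Y), cat_comp (cat_id Y) f = f;
  cat_compm1 : forall X Y (f : mor X Y), cat_comp f (cat_id X) = f;
  cat_compA : forall X Y Z W (h : mor Z W) (g : mor Y Z) (f : mor X Y),
    cat_comp h (cat_comp g f) = cat_comp (cat_comp h g) f }.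

Record functor (C D : category) := Functor {
  fobj :> C -> D;
  fmap : forall X Y, mor X Y -> mor (fobj X) (fobj Y);
  fmap_id : forall X, fmap (cat_id X) = cat_id (fobj X);
  fmap_comp : forall X Y Z (g : mor Y Z) (f : mor X Y),
    fmap (cat_comp g f) = cat_comp (fmap g) (fmap f) }.

Definition is_adjunction (C1 C2 : category) (F : functor C1 C2)
    (G : functor C2 C1)
    (chi : forall (A1 : C1) (A2 : C2), mor (F A1) A2 -> mor A1 (G A2)) : Prop :=
  (forall A1 A2, bijective (chi A1 A2)) /\
  (forall (A1 A1' : C1) (A2 A2' : C2)
      (h : mor A1' A1) (k : mor A2 A2') (f : mor (F A1) A2),
    chi A1' A2' (cat_comp k (cat_comp f (fmap F h)))
    = cat_comp (fmap G k) (cat_comp (chi A1 A2 f) h)).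

(* The tensor product over F of two finite-dimensional spaces V and W, in
   coordinates with respect to the library bases vbasis {:V} and vbasis {:W}:
   tens_pure v w is the tensor of v and w, and tens_lift phi is the linear
   extension of a bilinear map phi (tens_lift_pure and tens_ind give the
   universal property). *)
Section TensorProduct.
Variable F : fieldType.

Definition tens (V W : vectType F) := 'M[F]_(\dim {:V}, \dim {:W}).

Definition tens_pure (V W : vectType F) (v : V) (w : W) : tens V W :=
  \matrix_(i, j) (coord (vbasis {:V}) i v * coord (vbasis {:W}) j w).

Definition tens_lift (V W : vectType F) (E : lmodType F) (phi : V -> W -> E)
    (t : tens V W) : E :=
  \sum_i \sum_j t i j *: phi (vbasis {:V})`_i (vbasis {:W})`_j.

Definition bilinear_map (U V W : lmodType F) (phi : U -> V -> W) : Prop :=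
  (forall u, linear (phi u)) /\ (forall v, linear (phi^~ v)).

Lemma bilinear_suml (U V W : lmodType F) (phi : U -> V -> W) (I : finType)
    (x : I -> U) v :
  bilinear_map phi -> phi (\sum_i x i) v = \sum_i phi (x i) v.
Proof.
move=> [_ l]; pose f := GRing.isLinear.Build F U W *:%R (phi^~ v) (l v).
pose g : {linear U -> W} := HB.pack (phi^~ v) f.
exact: (raddf_sum g).
Qed.

Lemma bilinear_sumr (U V W : lmodType F) (phi : U -> V -> W) (I : finType)
    u (x : I -> V) :
  bilinear_map phi -> phi u (\sum_i x i) = \sum_i phi u (x i).
Proof.
move=> [l _]; pose f := GRing.isLinear.Build F V W *:%R (phi u) (l u).
pose g : {linear V -> W} := HB.pack (phi u) f.
exact: (raddf_sum g).
Qed.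

Lemma bilinear_0l (U V W : lmodType F) (phi : U -> V -> W) v :
  bilinear_map phi -> phi 0 v = 0.
Proof.
by move=> [_ l]; have := l v (-1) 0 0; rewrite scaler0 add0r scaleN1r addNr.
Qed.

Lemma bilinear_0r (U V W : lmodType F) (phi : U -> V -> W) u :
  bilinear_map phi -> phi u 0 = 0.
Proof.
by move=> [l _]; have := l u (-1) 0 0; rewrite scaler0 add0r scaleN1r addNr.
Qed.

Lemma bilinear_Zl (U V W : lmodType F) (phi : U -> V -> W) a u v :
  bilinear_map phi -> phi (a *: u) v = a *: phi u v.
Proof.
by move=> h; have := h.2 v a u 0; rewrite addr0 (bilinear_0l _ h) addr0.
Qed.

Lemma bilinear_Zr (U V W : lmodType F) (phi : U -> V -> W) a u v :
  bilinear_map phi -> phi u (a *: v) = a *: phi u v.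
Proof.
by move=> h; have := h.1 u a v 0; rewrite addr0 (bilinear_0r _ h) addr0.
Qed.

Lemma bilinear_expand (V W : vectType F) (E : lmodType F) (phi : V -> W -> E)
    v w : bilinear_map phi ->
  phi v w = \sum_i \sum_j (coord (vbasis {:V}) i v * coord (vbasis {:W}) j w)
                *: phi (vbasis {:V})`_i (vbasis {:W})`_j.
Proof.
move=> h.
rewrite {1}(coord_vbasis (memvf v)) {1}(coord_vbasis (memvf w)).
rewrite (bilinear_suml _ _ h); apply: eq_bigr => i _.
rewrite (bilinear_sumr _ _ h); apply: eq_bigr => j _.
by rewrite (bilinear_Zl _ _ _ h) (bilinear_Zr _ _ _ h) scalerA.
Qed.

Lemma tens_lift_pure (V W : vectType F) (E : lmodType F) (phi : V -> W -> E)
    v w : bilinear_map phi -> tens_lift phi (tens_pure v w) = phi v w.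
Proof.
move=> h; rewrite (bilinear_expand _ _ h).
by apply: eq_bigr => i _; apply: eq_bigr => j _; rewrite mxE.
Qed.

Lemma tens_pure_bilinear (V W : vectType F) :
  bilinear_map (@tens_pure V W).
Proof.
split=> [v a w w'|w a v v']; apply/matrixP => i j; rewrite !mxE linearP /=.
  by rewrite mulrDr mulrCA.
by rewrite mulrDl mulrA.
Qed.

Lemma tens_lift_linear (V W : vectType F) (E : lmodType F)
    (phi : V -> W -> E) : linear (tens_lift phi).
Proof.
move=> a s t; rewrite /tens_lift scaler_sumr -big_split; apply: eq_bigr => i _.
rewrite scaler_sumr -big_split; apply: eq_bigr => j _ /=.
by rewrite !mxE scalerDl scalerA.
Qed.

Lemma tens_lift_linear_map (V W : vectType F) (E : lmodType F) a
    (phi psi chi : V -> W -> E) t :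
  (forall v w, chi v w = a *: phi v w + psi v w) ->
  tens_lift chi t = a *: tens_lift phi t + tens_lift psi t.
Proof.
move=> e; rewrite /tens_lift scaler_sumr -big_split; apply: eq_bigr => i _.
rewrite scaler_sumr -big_split; apply: eq_bigr => j _ /=.
by rewrite e scalerDr !scalerA mulrC.
Qed.

Lemma tens_pure_basis (V W : vectType F)
    (i : 'I_(\dim {:V})) (j : 'I_(\dim {:W})) :
  tens_pure (vbasis {:V})`_i (vbasis {:W})`_j = delta_mx i j.
Proof.
apply/matrixP => k l; rewrite !mxE.
rewrite !coord_free ?(basis_free (vbasisP _)) // mulr_natr.
by rewrite -mulrnA -mulnb ![_ == k]eq_sym ![_ == l]eq_sym.
Qed.

Lemma tens_ind (V W : vectType F) (P : tens V W -> Prop) :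
  (forall a s t, P s -> P t -> P (a *: s + t)) ->
  (forall v w, P (tens_pure v w)) -> forall t, P t.
Proof.
move=> PD Pp t.
have P0 : P 0.
  by rewrite -(bilinear_0l 0 (tens_pure_bilinear V W)).
rewrite (matrix_sum_delta t).
elim/big_ind: _ => // [x y Px Py|i _]; first by rewrite -[x]scale1r; apply: PD.
elim/big_ind: _ => // [x y Px Py|j _]; first by rewrite -[x]scale1r; apply: PD.
by rewrite -[_ *: _]addr0; apply: PD => //; rewrite -tens_pure_basis.
Qed.
End TensorProduct.

Record linear_category (K : fieldType) := LinearCategory {
  lobj :> Type;
  hom : lobj -> lobj -> vectType K;
  idm : forall X, hom X X;
  comp : forall X Y Z, hom Y Z -> hom X Y -> hom X Z;
  comp1m : forall X Y (f : hom X Y), comp (idm Y) f = f;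
  compm1 : forall X Y (f : hom X Y), comp f (idm X) = f;
  compA : forall X Y Z W (h : hom Z W) (g : hom Y Z) (f : hom X Y),
    comp h (comp g f) = comp (comp h g) f;
  comp_bilinear : forall X Y Z, bilinear_map (@comp X Y Z) }.

Arguments idm {K l} X.
Notation "g ∘ f" := (comp g f) (at level 40, left associativity) : cat_scope.

Definition cat_of (K : fieldType) (L : linear_category K) : category :=
  Category (@comp1m K L) (@compm1 K L) (@compA K L).

Section LinearCategoryNotions.
Variables (K : fieldType) (L : linear_category K).

Definition inverse_pair (X Y : L) (f : hom X Y) (g : hom Y X) : Prop :=
  g ∘ f = idm X /\ f ∘ g = idm Y.

Definition iso (X Y : L) (f : hom X Y) : Prop := exists g, inverse_pair f g.

Definition isomorphic (X Y : L) : Prop := exists f : hom X Y, iso f.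

Definition mono (X Y : L) (f : hom X Y) : Prop :=
  forall Z (g h : hom Z X), f ∘ g = f ∘ h -> g = h.

Definition epi (X Y : L) (f : hom X Y) : Prop :=
  forall Z (g h : hom Y Z), g ∘ f = h ∘ f -> g = h.

Definition is_kernel (X Y Z : L) (f : hom X Y) (k : hom Z X) : Prop :=
  f ∘ k = 0 /\
  forall W (h : hom W X), f ∘ h = 0 -> exists! h' : hom W Z, k ∘ h' = h.

Definition is_cokernel (X Y Z : L) (f : hom X Y) (q : hom Y Z) : Prop :=
  q ∘ f = 0 /\
  forall W (h : hom Y W), h ∘ f = 0 -> exists! h' : hom Z W, h' ∘ q = h.

Definition is_zero (X : L) : Prop :=
  forall Y, (forall f : hom X Y, f = 0) /\ (forall f : hom Y X, f = 0).

Definition simple (U : L) : Prop :=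
  ~ is_zero U /\ forall X (m : hom X U), mono m -> is_zero X \/ iso m.

Record direct_sum (I : finType) (X : I -> L) := DirectSum {
  ds_obj :> L;
  inj : forall i, hom (X i) ds_obj;
  proj : forall i, hom ds_obj (X i);
  proj_inj : forall i, proj i ∘ inj i = idm (X i);
  proj_inj0 : forall i j, i != j -> proj j ∘ inj i = 0;
  sum_inj_proj : \sum_i (inj i ∘ proj i) = idm ds_obj }.

(* Finite direct sums are chosen rather than merely assumed to exist (the empty
   one is a zero object), because the functor T evaluates them. *)
Record abelian := Abelian {
  dsum : forall (I : finType) (X : I -> L), direct_sum X;
  has_kernel : forall X Y (f : hom X Y), exists Z (k : hom Z X), is_kernel f k;
  has_cokernel : forall X Y (f : hom X Y),
    exists Z (q : hom Y Z), is_cokernel f q;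
  mono_is_kernel : forall X Y (f : hom X Y), mono f ->
    exists Z (g : hom Y Z), is_kernel g f;
  epi_is_cokernel : forall X Y (f : hom X Y), epi f ->
    exists Z (g : hom Z X), is_cokernel g f }.

Definition semisimple (A : abelian) : Prop :=
  forall X, exists (I : finType) (S : I -> L),
    (forall i, simple (S i)) /\ isomorphic X (dsum A S).

Record simple_representatives := SimpleRepresentatives {
  sidx : finType;
  srep : sidx -> L;
  srep_simple : forall i, simple (srep i);
  srep_complete : forall U, simple U -> exists i, isomorphic U (srep i);
  srep_irredundant : forall i j, isomorphic (srep i) (srep j) -> i = j }.

(* For U simple the composite Hom(V,U) x Hom(U,V) -> End(U) = K idm U is a
   perfect pairing, so db_pairing determines db_dual. *)
Record dual_bases (V U : L) := DualBases {
  db_size : nat;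
  db : db_size.-tuple (hom V U);
  db_dual : db_size.-tuple (hom U V);
  db_basis : basis_of {:hom V U} db;
  db_pairing : forall a b,
    tnth db a ∘ tnth db_dual b = if a == b then idm U else 0 }.
End LinearCategoryNotions.

Record tensor_category (K : fieldType) := TensorCategory {
  tc_lin :> linear_category K;
  tob : tc_lin -> tc_lin -> tc_lin;
  tmor : forall X X' Y Y' : tc_lin,
    hom X X' -> hom Y Y' -> hom (tob X Y) (tob X' Y');
  tmor_bilinear : forall X X' Y Y', bilinear_map (@tmor X X' Y Y');
  tmor_id : forall X Y, tmor (idm X) (idm Y) = idm (tob X Y);
  tmor_comp : forall X X' X'' Y Y' Y'' (f' : hom X' X'') (f : hom X X')
      (g' : hom Y' Y'') (g : hom Y Y'),
    tmor (f' ∘ f) (g' ∘ g) = tmor f' g' ∘ tmor f g;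
  tunit : tc_lin;
  asso : forall X Y Z, hom (tob (tob X Y) Z) (tob X (tob Y Z));
  assoV : forall X Y Z, hom (tob X (tob Y Z)) (tob (tob X Y) Z);
  assoK : forall X Y Z, inverse_pair (asso X Y Z) (assoV X Y Z);
  asso_nat : forall X X' Y Y' Z Z'
      (f : hom X X') (g : hom Y Y') (h : hom Z Z'),
    asso X' Y' Z' ∘ tmor (tmor f g) h = tmor f (tmor g h) ∘ asso X Y Z;
  lun : forall X, hom (tob tunit X) X;
  lunV : forall X, hom X (tob tunit X);
  lunK : forall X, inverse_pair (lun X) (lunV X);
  lun_nat : forall X X' (f : hom X X'),
    lun X' ∘ tmor (idm tunit) f = f ∘ lun X;
  run : forall X, hom (tob X tunit) X;
  runV : forall X, hom X (tob X tunit);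
  runK : forall X, inverse_pair (run X) (runV X);
  run_nat : forall X X' (f : hom X X'),
    run X' ∘ tmor f (idm tunit) = f ∘ run X;
  triangle : forall X Y,
    tmor (idm X) (lun Y) ∘ asso X tunit Y = tmor (run X) (idm Y);
  pentagon : forall X Y Z W,
    asso X Y (tob Z W) ∘ asso (tob X Y) Z W
    = tmor (idm X) (asso Y Z W) ∘ asso X (tob Y Z) W
      ∘ tmor (asso X Y Z) (idm W) }.

Arguments tunit {K t}.
Arguments asso {K t} X Y Z.
Arguments assoV {K t} X Y Z.
Arguments lun {K t} X.
Arguments lunV {K t} X.
Arguments run {K t} X.
Arguments runV {K t} X.
Notation "X ⊗ Y" := (tob X Y) (at level 38, left associativity) : cat_scope.
Notation "f ⊗m g" := (tmor f g) (at level 38, left associativity) : cat_scope.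

Record ribbon_category (K : fieldType) := RibbonCategory {
  rc_tensor :> tensor_category K;
  br : forall X Y : rc_tensor, hom (X ⊗ Y) (Y ⊗ X);
  brV : forall X Y : rc_tensor, hom (Y ⊗ X) (X ⊗ Y);
  brK : forall X Y, inverse_pair (br X Y) (brV X Y);
  br_nat : forall (X X' Y Y' : rc_tensor) (f : hom X X') (g : hom Y Y'),
    br X' Y' ∘ (f ⊗m g) = (g ⊗m f) ∘ br X Y;
  hexagon1 : forall X Y Z,
    asso Y Z X ∘ br X (Y ⊗ Z) ∘ asso X Y Z
    = (idm Y ⊗m br X Z) ∘ asso Y X Z ∘ (br X Y ⊗m idm Z);
  hexagon2 : forall X Y Z,
    assoV Z X Y ∘ br (X ⊗ Y) Z ∘ assoV X Y Z
    = (br X Z ⊗m idm Y) ∘ assoV X Z Y ∘ (idm X ⊗m br Y Z);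
  tw : forall X : rc_tensor, hom X X;
  twV : forall X : rc_tensor, hom X X;
  twK : forall X, inverse_pair (tw X) (twV X);
  tw_nat : forall (X Y : rc_tensor) (f : hom X Y), tw Y ∘ f = f ∘ tw X;
  tw_tensor : forall X Y, tw (X ⊗ Y) = br Y X ∘ br X Y ∘ (tw X ⊗m tw Y);
  dual : rc_tensor -> rc_tensor;
  ev : forall X, hom (dual X ⊗ X) tunit;
  coev : forall X, hom tunit (X ⊗ dual X);
  zigzag : forall X,
    run X ∘ (idm X ⊗m ev X) ∘ asso X (dual X) X ∘ (coev X ⊗m idm X) ∘ lunV X
    = idm X;
  zagzig : forall X,
    lun (dual X) ∘ (ev X ⊗m idm (dual X)) ∘ assoV (dual X) X (dual X)
      ∘ (idm (dual X) ⊗m coev X) ∘ runV (dual X)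
    = idm (dual X);
  tw_dual : forall X,
    (tw X ⊗m idm (dual X)) ∘ coev X = (idm X ⊗m tw (dual X)) ∘ coev X }.

Arguments br {K r} X Y.
Arguments tw {K r} X.
Arguments ev {K r} X.
Arguments coev {K r} X.
Arguments dual {K r} X.

Section Mirror.
Variables (K : fieldType) (C : ribbon_category K).

Lemma inverse_uniq (L : linear_category K) (X Y : L) (f f' : hom X Y)
    (g g' : hom Y X) :
  inverse_pair f g -> inverse_pair f' g' -> f = f' -> g = g'.
Proof.
move=> [_ fg] [g'f' _] eff'; rewrite -eff' in g'f'.
by rewrite -[g]comp1m -g'f' -compA fg compm1.
Qed.

Lemma inverse_sym (L : linear_category K) (X Y : L) (f : hom X Y)
    (g : hom Y X) : inverse_pair f g -> inverse_pair g f.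
Proof. by case. Qed.

Lemma inverse_comp (L : linear_category K) (X Y Z : L) (f : hom X Y)
    (f' : hom Y X) (g : hom Y Z) (g' : hom Z Y) :
  inverse_pair f f' -> inverse_pair g g' -> inverse_pair (g ∘ f) (f' ∘ g').
Proof.
move=> [f1 f2] [g1 g2]; split.
  by rewrite -compA [g' ∘ (g ∘ f)]compA g1 comp1m.
by rewrite -compA [f ∘ (f' ∘ g')]compA f2 comp1m.
Qed.

Lemma inverse_id (L : linear_category K) (X : L) :
  inverse_pair (idm X) (idm X).
Proof. by split; rewrite comp1m. Qed.

Lemma inverse_tmor (X X' Y Y' : C) (f : hom X X') (f' : hom X' X)
    (g : hom Y Y') (g' : hom Y' Y) :
  inverse_pair f f' -> inverse_pair g g' ->
  inverse_pair (f ⊗m g) (f' ⊗m g').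
Proof.
by move=> [f1 f2] [g1 g2]; split; rewrite -tmor_comp ?f1 ?f2 ?g1 ?g2 tmor_id.
Qed.

Lemma mirror_brK (X Y : C) : inverse_pair (brV Y X) (br Y X).
Proof. exact/inverse_sym/brK. Qed.

Lemma mirror_br_nat (X X' Y Y' : C) (f : hom X X') (g : hom Y Y') :
  brV Y' X' ∘ (f ⊗m g) = (g ⊗m f) ∘ brV Y X.
Proof.
have [h1 h2] := brK Y' X'; have [k1 k2] := brK Y X.
rewrite -[LHS]compm1 -k2 compA -[_ ∘ br Y X]compA -br_nat.
by rewrite !compA h1 comp1m.
Qed.

Lemma mirror_hexagon1 (X Y Z : C) :
  asso Y Z X ∘ brV (Y ⊗ Z) X ∘ asso X Y Z
  = (idm Y ⊗m brV Z X) ∘ asso Y X Z ∘ (brV Y X ⊗m idm Z).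
Proof.
apply: (inverse_uniq _ _ (hexagon2 Y Z X)).
  rewrite -compA; apply: inverse_comp; last exact/inverse_sym/assoK.
  by apply: inverse_comp (brK _ _); apply/inverse_sym/assoK.
rewrite -compA; apply: inverse_comp.
  apply: inverse_comp; last exact/inverse_sym/assoK.
  exact: inverse_tmor (inverse_id _) (brK _ _).
exact: inverse_tmor (brK _ _) (inverse_id _).
Qed.

Lemma mirror_hexagon2 (X Y Z : C) :
  assoV Z X Y ∘ brV Z (X ⊗ Y) ∘ assoV X Y Z
  = (brV Z X ⊗m idm Y) ∘ assoV X Z Y ∘ (idm X ⊗m brV Z Y).
Proof.
apply: (inverse_uniq _ _ (hexagon1 Z X Y)).
  rewrite -compA; apply: inverse_comp; last exact/assoK.
  by apply: inverse_comp (brK _ _); apply/assoK.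
rewrite -compA; apply: inverse_comp.
  apply: inverse_comp; last exact/assoK.
  exact: inverse_tmor (brK _ _) (inverse_id _).
exact: inverse_tmor (inverse_id _) (brK _ _).
Qed.

Lemma mirror_tw_nat (X Y : C) (f : hom X Y) : twV Y ∘ f = f ∘ twV X.
Proof.
have [h1 h2] := twK Y; have [k1 k2] := twK X.
rewrite -[LHS]compm1 -k2 compA -[_ ∘ tw X]compA -tw_nat.
by rewrite !compA h1 comp1m.
Qed.

Lemma mirror_tw_tensor (X Y : C) :
  twV (X ⊗ Y) = brV X Y ∘ brV Y X ∘ (twV X ⊗m twV Y).
Proof.
rewrite -compA mirror_br_nat compA mirror_br_nat -compA.
apply: (inverse_uniq (twK _) _ (tw_tensor X Y)).
apply: inverse_comp; first exact: inverse_tmor (twK _) (twK _).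
by apply: inverse_comp; apply: brK.
Qed.

Lemma mirror_tw_dual (X : C) :
  (twV X ⊗m idm (dual X)) ∘ coev X = (idm X ⊗m twV (dual X)) ∘ coev X.
Proof.
have [h1 _] := inverse_tmor (twK X) (twK (dual X)).
have [a1 a2] := twK X; have [b1 b2] := twK (dual X).
have e : (twV X ⊗m twV (dual X)) ∘ ((tw X ⊗m idm (dual X)) ∘ coev X)
  = (twV X ⊗m twV (dual X)) ∘ ((idm X ⊗m tw (dual X)) ∘ coev X).
  by rewrite tw_dual.
by rewrite !compA -!tmor_comp a1 b1 !compm1 in e.
Qed.

Definition mirror : ribbon_category K :=
  RibbonCategory mirror_brK mirror_br_nat mirror_hexagon1 mirror_hexagon2
    (fun X => inverse_sym (twK X)) mirror_tw_nat mirror_tw_tensor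
    (@zigzag K C) (@zagzig K C) mirror_tw_dual.
End Mirror.

(* Pivotal structure, trace and dimension of a ribbon category.  The duality
   maps with the dual object on the other side are induced by braiding and
   twist.  End(1) is identified with K through the coordinate with respect to
   idm tunit, which is a basis of End(1) when tunit is absolutely simple. *)
Section Ribbon.
Variables (K : fieldType) (C : ribbon_category K).

Definition ev' (X : C) : hom (X ⊗ dual X) tunit :=
  ev X ∘ br X (dual X) ∘ (tw X ⊗m idm (dual X)).

Definition coev' (X : C) : hom tunit (dual X ⊗ X) :=
  (idm (dual X) ⊗m tw X) ∘ br X (dual X) ∘ coev X.

Definition scalar_of (f : hom (tunit : C) tunit) : K :=
  coord [tuple idm (tunit : C)] ord0 f.

Definition tr (X : C) (f : hom X X) : K :=
  scalar_of (ev X ∘ (idm (dual X) ⊗m f) ∘ coev' X).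

Definition qdim (X : C) : K := scalar_of (ev X ∘ coev' X).
End Ribbon.

Record modular_category (K : fieldType) := ModularCategory {
  mc_ribbon :> ribbon_category K;
  mc_abelian : abelian mc_ribbon;
  mc_semisimple : semisimple mc_abelian;
  mc_simples : simple_representatives mc_ribbon;
  mc_unit_simple : simple (tunit : mc_ribbon);
  mc_s_unit : \matrix_(i < #|sidx mc_simples|, j < #|sidx mc_simples|)
      (let Ui := srep (enum_val i) in let Uj := srep (enum_val j) in
       tr (br Uj Ui ∘ br Ui Uj)) \in unitmx }.

Definition simple_index (K : fieldType) (C : modular_category K) : finType :=
  sidx (mc_simples C).

Definition simple_ob (K : fieldType) (C : modular_category K)
  (i : simple_index C) : C := srep i.

Definition total_dim (K : fieldType) (C : modular_category K) : K :=
  \sum_(i : simple_index C) qdim (simple_ob i) ^+ 2.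

Section DeligneProduct.
Variables (K : fieldType) (L1 L2 : linear_category K).

(* The Deligne product of semisimple categories: formal finite direct sums of
   pairs, with matrices of elements of tensor products of Hom spaces. *)
Record formal_sum := FormalSum {
  fs_idx : finType;
  fs_l : fs_idx -> L1;
  fs_r : fs_idx -> L2 }.

Definition pair_hom (V : L1) (W : L2) (V' : L1) (W' : L2) :=
  tens (hom V V') (hom W W').

Definition pair_comp V W V' W' V'' W''
    (t : pair_hom V' W' V'' W'') (s : pair_hom V W V' W') :
    pair_hom V W V'' W'' :=
  tens_lift (fun f' g' =>
    tens_lift (fun f g => tens_pure (f' ∘ f) (g' ∘ g)) s) t.

Definition fs_hom (M N : formal_sum) : Type :=
  forall (m : fs_idx M) (n : fs_idx N),
    pair_hom (fs_l m) (fs_r m) (fs_l n) (fs_r n).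

Definition fs_id (M : formal_sum) : fs_hom M M :=
  fun m => dfwith (fun n => 0) (tens_pure (idm (fs_l m)) (idm (fs_r m))).
Arguments fs_id M : clear implicits.

Definition fs_comp (M N P : formal_sum) (t : fs_hom N P) (s : fs_hom M N) :
    fs_hom M P :=
  fun m p => \sum_n pair_comp (t n p) (s m n).

Lemma pair_comp_bilinear V W V' W' V'' W'' :
  bilinear_map (@pair_comp V W V' W' V'' W'').
Proof.
split=> [t a s s'|s a t t']; last exact: tens_lift_linear.
by apply: tens_lift_linear_map => f g; apply: tens_lift_linear.
Qed.

Lemma tens_pure_comp_bilinear V W V' W' V'' W''
    (f' : hom V' V'') (g' : hom W' W'') :
  bilinear_map (fun (f : hom V V') (g : hom W W') =>
    (tens_pure (f' ∘ f) (g' ∘ g) : pair_hom V W V'' W'')).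
Proof.
split=> [f a g h|g a f h].
  by rewrite (comp_bilinear _ _ _).1 (tens_pure_bilinear _ _).1.
by rewrite (comp_bilinear _ _ _).1 (tens_pure_bilinear _ _).2.
Qed.

Lemma pair_comp_pure V W V' W' V'' W'' (f' : hom V' V'') (g' : hom W' W'')
    (f : hom V V') (g : hom W W') :
  pair_comp (tens_pure f' g') (tens_pure f g)
  = tens_pure (f' ∘ f) (g' ∘ g) :> pair_hom V W V'' W''.
Proof.
rewrite /pair_comp tens_lift_pure.
  by rewrite tens_lift_pure //; apply: tens_pure_comp_bilinear.
split=> [{}f' a h h'|h a {}f' h'].
  rewrite !tens_lift_pure; try exact: tens_pure_comp_bilinear.
  by rewrite (comp_bilinear _ _ _).2 (tens_pure_bilinear _ _).1.
rewrite !tens_lift_pure; try exact: tens_pure_comp_bilinear.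
by rewrite (comp_bilinear _ _ _).2 (tens_pure_bilinear _ _).2.
Qed.

Lemma pair_compA V W V' W' V'' W'' V''' W'''
    (u : pair_hom V'' W'' V''' W''') (t : pair_hom V' W' V'' W'')
    (s : pair_hom V W V' W') :
  pair_comp u (pair_comp t s) = pair_comp (pair_comp u t) s.
Proof.
have B := pair_comp_bilinear.
move: u; apply: tens_ind => [a u u' Pu Pu'|f'' g''].
  by rewrite !(B _ _ _ _ _ _).2 Pu Pu'.
move: t; apply: tens_ind => [a t t' Pt Pt'|f' g'].
  by rewrite (B _ _ _ _ _ _).2 !(B _ _ _ _ _ _).1 (B _ _ _ _ _ _).2 Pt Pt'.
move: s; apply: tens_ind => [a s s' Ps Ps'|f g].
  by rewrite !(B _ _ _ _ _ _).1 Ps Ps'.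
by rewrite !pair_comp_pure !compA.
Qed.

Lemma pair_comp1m V W V' W' (s : pair_hom V W V' W') :
  pair_comp (tens_pure (idm V') (idm W')) s = s.
Proof.
move: s; apply: tens_ind => [a s s' Ps Ps'|f g].
  by rewrite (pair_comp_bilinear _ _ _ _ _ _).1 Ps Ps'.
by rewrite pair_comp_pure !comp1m.
Qed.

Lemma pair_compm1 V W V' W' (s : pair_hom V W V' W') :
  pair_comp s (tens_pure (idm V) (idm W)) = s.
Proof.
move: s; apply: tens_ind => [a s s' Ps Ps'|f g].
  by rewrite (pair_comp_bilinear _ _ _ _ _ _).2 Ps Ps'.
by rewrite pair_comp_pure !compm1.
Qed.

Lemma fs_ext (M N : formal_sum) (s t : fs_hom M N) :
  (forall m n, s m n = t m n) -> s = t.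
Proof.
by move=> e; apply: functional_extensionality_dep => m;
  apply: functional_extensionality_dep => n; apply: e.
Qed.

Lemma fs_comp1m (M N : formal_sum) (s : fs_hom M N) : fs_comp (fs_id N) s = s.
Proof.
apply: fs_ext => m n; rewrite /fs_comp (bigD1 n) //= big1 ?addr0.
  by rewrite /fs_id dfwith_in pair_comp1m.
move=> k kn; rewrite /fs_id dfwith_out //.
exact/bilinear_0l/pair_comp_bilinear.
Qed.

Lemma fs_compm1 (M N : formal_sum) (s : fs_hom M N) : fs_comp s (fs_id M) = s.
Proof.
apply: fs_ext => m n; rewrite /fs_comp (bigD1 m) //= big1 ?addr0.
  by rewrite /fs_id dfwith_in pair_compm1.
move=> k km; rewrite /fs_id dfwith_out 1?eq_sym //.
exact/bilinear_0r/pair_comp_bilinear.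
Qed.

Lemma fs_compA (M N P Q : formal_sum) (u : fs_hom P Q) (t : fs_hom N P)
    (s : fs_hom M N) :
  fs_comp u (fs_comp t s) = fs_comp (fs_comp u t) s.
Proof.
apply: fs_ext => m q; rewrite /fs_comp.
under eq_bigr do rewrite (bilinear_sumr _ _ (pair_comp_bilinear _ _ _ _ _ _)).
rewrite exchange_big; apply: eq_bigr => n _ /=.
rewrite (bilinear_suml _ _ (pair_comp_bilinear _ _ _ _ _ _)).
by apply: eq_bigr => p _; rewrite pair_compA.
Qed.

Definition boxtimes : category := Category fs_comp1m fs_compm1 fs_compA.
End DeligneProduct.

Section Functors.
Variables (K : fieldType) (C : modular_category K).

(* The braiding and twist of the two factors do not enter the underlying
   category. *)
Definition C2 : category := boxtimes C (mirror C).

Definition T_sum (M : formal_sum C (mirror C)) :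
    direct_sum (fun m : fs_idx M => tob (fs_l m : C) (fs_r m : C)) :=
  dsum (mc_abelian C) _.

Definition T_ob (M : C2) : C := T_sum M.

Definition pair_tmor (V W V' W' : C) (t : tens (hom V V') (hom W W')) :
    hom (V ⊗ W) (V' ⊗ W') :=
  tens_lift (fun (f : hom V V') (g : hom W W') => f ⊗m g) t.

Definition T_mor (M N : C2) (t : mor M N) : hom (T_ob M) (T_ob N) :=
  \sum_m \sum_n inj (T_sum N) n ∘ pair_tmor (t m n) ∘ proj (T_sum M) m.

Lemma pair_tmor_pure (V W V' W' : C) (f : hom V V') (g : hom W W') :
  pair_tmor (tens_pure f g) = f ⊗m g.
Proof. exact/tens_lift_pure/tmor_bilinear. Qed.

Lemma pair_tmor_comp (V W V' W' V'' W'' : C)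
    (t : tens (hom V' V'') (hom W' W'')) (s : tens (hom V V') (hom W W')) :
  pair_tmor (pair_comp t s) = pair_tmor t ∘ pair_tmor s.
Proof.
move: t; apply: tens_ind => [a t t' Pt Pt'|f' g'].
  rewrite (pair_comp_bilinear _ _ _ _ _ _).2 /pair_tmor !tens_lift_linear.
  by rewrite (comp_bilinear _ _ _).2 -Pt -Pt'.
move: s; apply: tens_ind => [a s s' Ps Ps'|f g].
  rewrite (pair_comp_bilinear _ _ _ _ _ _).1 /pair_tmor !tens_lift_linear.
  by rewrite (comp_bilinear _ _ _).1 -Ps -Ps'.
by rewrite pair_comp_pure !pair_tmor_pure tmor_comp.
Qed.

Lemma T_mor_id (M : C2) : T_mor (cat_id M) = idm (T_ob M).
Proof.
rewrite -[RHS]sum_inj_proj; apply: eq_bigr => m _.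
rewrite (bigD1 m) //= big1 ?addr0.
  by rewrite /fs_id dfwith_in pair_tmor_pure tmor_id compm1.
move=> n nm; rewrite /fs_id dfwith_out 1?eq_sym //.
have -> : @pair_tmor (fs_l m) (fs_r m) (fs_l n) (fs_r n) 0 = 0.
  by rewrite /pair_tmor /tens_lift big1 // => i _; rewrite big1 // => j _;
    rewrite mxE scale0r.
by rewrite (bilinear_0r _ (comp_bilinear _ _ _))
  (bilinear_0l _ (comp_bilinear _ _ _)).
Qed.

Lemma pair_tmor_sum (V W V' W' : C) (I : finType)
    (t : I -> tens (hom V V') (hom W W')) :
  pair_tmor (\sum_i t i) = \sum_i pair_tmor (t i).
Proof.
pose f := GRing.isLinear.Build K _ _ *:%R (@pair_tmor V W V' W')
  (tens_lift_linear _).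
pose g : {linear _ -> _} := HB.pack (@pair_tmor V W V' W') f.
exact: (raddf_sum g).
Qed.

Lemma T_mor_comp (M N P : C2) (t : mor N P) (s : mor M N) :
  T_mor (cat_comp t s) = T_mor t ∘ T_mor s.
Proof.
have suml := fun X Y Z (I : finType) x v => @bilinear_suml K _ _ _
  (@comp K C X Y Z) I x v (comp_bilinear X Y Z).
have sumr := fun X Y Z (I : finType) u x => @bilinear_sumr K _ _ _
  (@comp K C X Y Z) I u x (comp_bilinear X Y Z).
rewrite /T_mor sumr; apply: eq_bigr => m _.
rewrite sumr; under [LHS]eq_bigr do rewrite pair_tmor_sum sumr suml.
rewrite [LHS]exchange_big; apply: eq_bigr => n _ /=.
rewrite [RHS]suml [RHS](bigD1 n) //= [X in _ + X]big1 ?addr0 => [|n' n'n].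
  rewrite suml. apply: eq_bigr => p _; rewrite pair_tmor_comp !compA.
  by rewrite -(compA _ (proj _ n) (inj _ n)) proj_inj compm1.
rewrite suml big1 // => p _; rewrite !compA.
rewrite -(compA _ (proj _ n') (inj _ n)) proj_inj0 1?eq_sym //.
by rewrite (bilinear_0r _ (comp_bilinear _ _ _))
  !(bilinear_0l _ (comp_bilinear _ _ _)).
Qed.

Definition functor_T : functor C2 (cat_of C) := 
  @Functor C2 (cat_of C) T_ob T_mor T_mor_id T_mor_comp.

Definition R_ob (A : C) : C2 :=
  @FormalSum K C (mirror C) (simple_index C)
    (fun i => A ⊗ dual (simple_ob i)) (fun i => simple_ob i).

Definition R_mor (A B : C) (f : hom A B) : @mor C2 (R_ob A) (R_ob B) :=
  fun i => dfwith (fun=> 0)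
    (tens_pure (f ⊗m idm (dual (simple_ob i))) (idm (simple_ob i))).

Lemma R_mor_id (A : C) : R_mor (idm A) = cat_id (R_ob A).
Proof. by apply: fs_ext => i j; rewrite /R_mor tmor_id. Qed.

Lemma R_mor_comp (A B D : C) (g : hom B D) (f : hom A B) :
  R_mor (g ∘ f) = cat_comp (R_mor g) (R_mor f).
Proof.
apply: fs_ext => i k; rewrite /= /fs_comp (bigD1 i) //= big1 ?addr0.
  rewrite /R_mor dfwith_in; have [<-|ik] := eqVneq i k.
    by rewrite !dfwith_in pair_comp_pure -tmor_comp !comp1m.
  rewrite !dfwith_out //.
  by rewrite (bilinear_0l _ (pair_comp_bilinear _ _ _ _ _ _)).
move=> j ji; rewrite {2}/R_mor dfwith_out 1?eq_sym //.
exact/bilinear_0r/pair_comp_bilinear.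
Qed.

Definition functor_R : functor (cat_of C) C2 :=
  @Functor (cat_of C) C2 R_ob R_mor R_mor_id R_mor_comp.
End Functors.

Section AdjunctionMaps.
Variables (K : fieldType) (C : modular_category K).
Variable b : forall (V : C) (i : simple_index C), dual_bases V (simple_ob i).

(* assoV, asso, runV and run replace the suppressed associators and unit
   isomorphisms of the strict formulas. *)
Definition chi_hat (M : C2 C) (A : C) (f : hom (T_ob M) A) :
    @mor (C2 C) M (R_ob A) :=
  fun n i =>
    let f_n := f ∘ inj (T_sum M) n in
    let Ml : C := fs_l n in
    let Mr : C := fs_r n in
    let U := simple_ob i in
    \sum_a tens_pure
      ((f_n ⊗m idm (dual U)) ∘ assoV Ml Mr (dual U)
       ∘ (idm Ml ⊗m (tnth (db_dual (b Mr i)) a ⊗m idm (dual U)))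
       ∘ (idm Ml ⊗m coev U) ∘ runV Ml)
      (tnth (db (b Mr i)) a : @hom K (mirror C) Mr U).

Definition chi_check (A : C) (M : C2 C) (g : hom A (T_ob M)) :
    @mor (C2 C) (R_ob A) M :=
  fun i n =>
    let g_n := proj (T_sum M) n ∘ g in
    let Ml : C := fs_l n in
    let Mr : C := fs_r n in
    let U := simple_ob i in
    \sum_a (total_dim C / qdim U) *: tens_pure
      (run Ml ∘ (idm Ml ⊗m ev' U)
       ∘ (idm Ml ⊗m (tnth (db (b Mr i)) a ⊗m idm (dual U)))
       ∘ asso Ml Mr (dual U) ∘ (g_n ⊗m idm (dual U)))
      (tnth (db_dual (b Mr i)) a : @hom K (mirror C) U Mr).
End AdjunctionMaps.

(* Main.v *)
(* Tensoring on the right with U_i is adjoint to tensoring with its dual on both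
   sides, through (ev, coev) and through (ev', coev').  In a semisimple category
   every V decomposes as the sum of its b-dual pairs, which turns this into the
   bijections for T and R.  The maps chi_check also need dim U_i <> 0 and
   Dim C <> 0.  The first holds since Hom(U^∨ ⊗ U, 1) is spanned by ev.  For the
   second, d_X d_j = sum_k N_X(j,k) d_k, where N_X(j,k) = dim Hom(X ⊗ U_j, U_k),
   and the matrix of the dual of X is the transpose of N_X.  Pairing d with its
   complex conjugate gives d_X = conj(d_{X^∨}) = conj(d_X), so all dimensions are
   real and Dim C is a sum of squares of nonzero reals. *)
From HB Require Import structures.
From Pilot Require (* MathComp shadows hom and comp. *)
Import Defs.
From mathcomp Require Import all_boot all_order all_algebra.
From mathcomp Require Import reals complex.
Import Defs.

Set Implicit Arguments.
Unset Strict Implicit.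
Unset Printing Implicit Defensive.

Import GRing.Theory Num.Theory.
Local Open Scope ring_scope.
Local Open Scope cat_scope.

Local Notation "X ◁ f" := (idm X ⊗m f) (at level 38, left associativity).
Local Notation "f ▷ X" := (f ⊗m idm X) (at level 38, left associativity).
Local Notation "X ^∨" := (dual X) (at level 2, format "X ^∨").

(** The ribbon structure supplies only [ev] and [coev]; [ev'] and [coev'] are composites with
    braiding and twist. The second pair of zigzag identities, the multiplicativity of [qdim] and its
    invariance under duals are therefore derived from the hexagons and the twist axioms, over
    nontrivial associators. To this end every cup, cap and crossing acts beside a bystander object
    [Z]: the hexagons become rules for sliding a strand over a cup or a cap, and a closed loop
    becomes the endomorphism [qdim X *: idm Z], so that loops can be nested. The inverses of both
    maps have formulas free of dual bases, which makes naturality a componentwise check; the bases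
    enter only where an identity is resolved into dual pairs. The factor Dim C / dim U_i is attached
    to the index i, in which [R] acts diagonally, so it passes through the naturality squares. *)

Section LinearCategory.
Variables (K : fieldType) (L : linear_category K).
Implicit Types X Y Z W : L.

(* Composites are kept left-nested; comp_rew2 and comp_rew3 rewrite a factor of
   two or three morphisms in the middle of such a chain. *)
Lemma comp_rew2 X Y Z (a : hom Y Z) (b : hom X Y) (r : hom X Z) :
  a ∘ b = r -> forall W (x : hom Z W), x ∘ a ∘ b = x ∘ r.
Proof. by move=> <- W x; rewrite compA. Qed.

Lemma comp_rew3 X Y Z Y' (a : hom Y' Z) (b : hom Y Y') (c : hom X Y)
    (r : hom X Z) :
  a ∘ b ∘ c = r -> forall W (x : hom Z W), x ∘ a ∘ b ∘ c = x ∘ r.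
Proof. by move=> <- W x; rewrite !compA. Qed.

Lemma cancel_epi X Y Z (f : hom X Y) (f' : hom Y X) (x y : hom Y Z) :
  f ∘ f' = idm Y -> x ∘ f = y ∘ f -> x = y.
Proof. by move=> e xy; rewrite -[x]compm1 -[y]compm1 -e !compA xy. Qed.

Lemma cancel_mono X Y Z (f : hom Y Z) (f' : hom Z Y) (x y : hom X Y) :
  f' ∘ f = idm Y -> f ∘ x = f ∘ y -> x = y.
Proof. by move=> e xy; rewrite -[x]comp1m -[y]comp1m -e -!compA xy. Qed.

Lemma comp0m X Y Z (f : hom X Y) : (0 : hom Y Z) ∘ f = 0.
Proof. exact: bilinear_0l (comp_bilinear _ _ _). Qed.

Lemma compm0 X Y Z (f : hom Y Z) : f ∘ (0 : hom X Y) = 0.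
Proof. exact: bilinear_0r (comp_bilinear _ _ _). Qed.

Lemma compZm a X Y Z (f : hom Y Z) (g : hom X Y) : (a *: f) ∘ g = a *: (f ∘ g).
Proof. exact: bilinear_Zl (comp_bilinear _ _ _). Qed.

Lemma compmZ a X Y Z (f : hom Y Z) (g : hom X Y) : f ∘ (a *: g) = a *: (f ∘ g).
Proof. exact: bilinear_Zr (comp_bilinear _ _ _). Qed.

Lemma comp_suml (I : finType) X Y Z (f : I -> hom Y Z) (g : hom X Y) :
  (\sum_i f i) ∘ g = \sum_i (f i ∘ g).
Proof. exact: bilinear_suml (comp_bilinear _ _ _). Qed.

Lemma comp_sumr (I : finType) X Y Z (g : hom Y Z) (f : I -> hom X Y) :
  g ∘ (\sum_i f i) = \sum_i (g ∘ f i).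
Proof. exact: bilinear_sumr (comp_bilinear _ _ _). Qed.

Lemma compmD X Y Z (f : hom Y Z) (g g' : hom X Y) :
  f ∘ (g + g') = f ∘ g + f ∘ g'.
Proof. by have := (comp_bilinear X Y Z).1 f 1 g g'; rewrite !scale1r. Qed.

Lemma compmN X Y Z (f : hom Y Z) (g : hom X Y) : f ∘ (- g) = - (f ∘ g).
Proof. by rewrite -scaleN1r compmZ scaleN1r. Qed.
End LinearCategory.

(** * Coherence in a monoidal category *)

Section Tensor.
Variables (K : fieldType) (C : tensor_category K).
Implicit Types X Y Z W A B : C.
Local Notation "𝟙" := (tunit : C).

Lemma whl_comp X Y Z W (g : hom Z W) (f : hom Y Z) :
  X ◁ (g ∘ f) = X ◁ g ∘ X ◁ f.
Proof. by rewrite -tmor_comp comp1m. Qed.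

Lemma whr_comp X Y Z W (g : hom Z W) (f : hom Y Z) :
  (g ∘ f) ▷ X = g ▷ X ∘ f ▷ X.
Proof. by rewrite -tmor_comp comp1m. Qed.

Lemma whr_whl X Y X' Y' (f : hom X X') (g : hom Y Y') :
  (f ▷ Y') ∘ (X ◁ g) = (X' ◁ g) ∘ (f ▷ Y).
Proof. by rewrite -!tmor_comp !comp1m !compm1. Qed.

Lemma tmor_sumr (I : finType) X Y Z W (f : hom X Y) (g : I -> hom Z W) :
  f ⊗m (\sum_i g i) = \sum_i f ⊗m g i.
Proof. exact: bilinear_sumr (tmor_bilinear _ _ _ _). Qed.

Lemma tmor0l X Y Z W (g : hom Z W) : (0 : hom X Y) ⊗m g = 0.
Proof. exact: bilinear_0l (tmor_bilinear _ _ _ _). Qed.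

Lemma tmor0r X Y Z W (f : hom X Y) : f ⊗m (0 : hom Z W) = 0.
Proof. exact: bilinear_0r (tmor_bilinear _ _ _ _). Qed.

Lemma tmorZl a X Y Z W (f : hom X Y) (g : hom Z W) :
  (a *: f) ⊗m g = a *: (f ⊗m g).
Proof. exact: bilinear_Zl (tmor_bilinear _ _ _ _). Qed.

Lemma tmorZr a X Y Z W (f : hom X Y) (g : hom Z W) :
  f ⊗m (a *: g) = a *: (f ⊗m g).
Proof. exact: bilinear_Zr (tmor_bilinear _ _ _ _). Qed.

Lemma assoVK X Y Z : asso X Y Z ∘ assoV X Y Z = idm _.
Proof. by case: (assoK X Y Z). Qed.
Lemma assoKV X Y Z : assoV X Y Z ∘ asso X Y Z = idm _.
Proof. by case: (assoK X Y Z). Qed.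
Lemma lunVK X : lun X ∘ lunV X = idm X.
Proof. by case: (lunK X). Qed.
Lemma lunKV X : lunV X ∘ lun X = idm _.
Proof. by case: (lunK X). Qed.
Lemma runVK X : run X ∘ runV X = idm X.
Proof. by case: (runK X). Qed.
Lemma runKV X : runV X ∘ run X = idm _.
Proof. by case: (runK X). Qed.

Lemma assoV_nat X X' Y Y' Z Z' (f : hom X X') (g : hom Y Y') (h : hom Z Z') :
  assoV X' Y' Z' ∘ (f ⊗m (g ⊗m h)) = ((f ⊗m g) ⊗m h) ∘ assoV X Y Z.
Proof.
apply: (cancel_mono (assoKV _ _ _)).
by rewrite !compA assoVK asso_nat -compA assoVK comp1m compm1.
Qed.

Lemma lunV_nat X X' (f : hom X X') : lunV X' ∘ f = (𝟙 ◁ f) ∘ lunV X.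
Proof.
apply: (cancel_mono (lunKV _)).
by rewrite !compA lunVK lun_nat -compA lunVK comp1m compm1.
Qed.

Lemma runV_nat X X' (f : hom X X') : runV X' ∘ f = (f ▷ 𝟙) ∘ runV X.
Proof.
apply: (cancel_mono (runKV _)).
by rewrite !compA runVK run_nat -compA runVK comp1m compm1.
Qed.

Lemma whl_unit_inj X Y (f g : hom X Y) : 𝟙 ◁ f = 𝟙 ◁ g -> f = g.
Proof.
by move=> e; apply: (cancel_epi (lunVK X)); rewrite -!lun_nat e.
Qed.

Lemma whr_unit_inj X Y (f g : hom X Y) : f ▷ 𝟙 = g ▷ 𝟙 -> f = g.
Proof.
by move=> e; apply: (cancel_epi (runVK X)); rewrite -!run_nat e.
Qed.

Lemma whr_id_comp X Y Z (f : hom X Y) (g : hom Y X) :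
  g ∘ f = idm X -> g ▷ Z ∘ f ▷ Z = idm _.
Proof. by move=> e; rewrite -whr_comp e tmor_id. Qed.

Lemma whl_id_comp X Y Z (f : hom X Y) (g : hom Y X) :
  g ∘ f = idm X -> Z ◁ g ∘ Z ◁ f = idm _.
Proof. by move=> e; rewrite -whl_comp e tmor_id. Qed.

(** Kelly's argument: tensoring with 𝟙 on the left is faithful, and after it the claim follows from
    the pentagon at 𝟙, 𝟙, X, Y and the triangle. *)
Lemma lun_tensor X Y : lun (X ⊗ Y) ∘ asso 𝟙 X Y = lun X ▷ Y.
Proof.
apply: whl_unit_inj.
apply: (cancel_epi (assoVK 𝟙 (𝟙 ⊗ X) Y)).
apply: (cancel_epi (whr_id_comp Y (assoVK 𝟙 𝟙 X))).
rewrite -asso_nat -[RHS]compA -whr_comp triangle asso_nat tmor_id -triangle.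
by rewrite whl_comp -[RHS]compA pentagon !compA.
Qed.

Lemma run_tensor X Y : X ◁ run Y ∘ asso X Y 𝟙 = run (X ⊗ Y).
Proof.
apply: whr_unit_inj; rewrite whr_comp.
apply: (cancel_mono (assoKV X Y 𝟙)).
rewrite compA asso_nat -(triangle Y) whl_comp.
rewrite (comp_rew3 (esym (pentagon X Y 𝟙 𝟙))) -(triangle (X ⊗ Y) 𝟙) !compA.
by rewrite -[idm (X ⊗ Y)]tmor_id asso_nat.
Qed.

(** Naturality of [lun] at the morphism [lun 𝟙] gives [lun (𝟙 ⊗ 𝟙) = 𝟙 ◁ lun 𝟙]; the triangle and
    [lun_tensor] then compare both sides. *)
Lemma lun_run_unit : lun 𝟙 = run 𝟙.
Proof.
apply: whr_unit_inj; rewrite -triangle -lun_tensor; congr (_ ∘ _).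
by apply: (cancel_mono (lunKV _)); rewrite lun_nat.
Qed.

Lemma lunV_tensor X Y : lunV (X ⊗ Y) = asso 𝟙 X Y ∘ lunV X ▷ Y.
Proof.
apply: (cancel_mono (lunKV _)); rewrite compA lun_tensor lunVK.
by rewrite whr_id_comp // lunVK.
Qed.

Lemma runV_tensor X Y : runV (X ⊗ Y) = assoV X Y 𝟙 ∘ X ◁ runV Y.
Proof.
apply: (cancel_mono (runKV _)); rewrite -{2}run_tensor runVK compA.
by rewrite (comp_rew2 (assoVK _ _ _)) compm1 whl_id_comp // runVK.
Qed.

Lemma triangleV X Y :
  assoV X 𝟙 Y ∘ X ◁ lunV Y = runV X ▷ Y.
Proof.
apply: (@cancel_mono _ _ _ _ _ (run X ▷ Y) (runV X ▷ Y)).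
  by rewrite whr_id_comp // runKV.
rewrite whr_id_comp ?runVK // -triangle compA (comp_rew2 (assoVK _ _ _)).
by rewrite compm1 whl_id_comp // lunVK.
Qed.

Lemma pentagonV X Y Z W :
  assoV (X ⊗ Y) Z W ∘ assoV X Y (Z ⊗ W)
  = assoV X Y Z ▷ W ∘ assoV X (Y ⊗ Z) W ∘ X ◁ assoV Y Z W.
Proof.
apply: (cancel_epi (assoVK X Y (Z ⊗ W))).
apply: (cancel_epi (assoVK (X ⊗ Y) Z W)).
rewrite (comp_rew2 (assoKV _ _ _)) compm1 assoKV.
rewrite (comp_rew2 (pentagon _ _ _ _)) !compA.
rewrite (comp_rew2 (whl_id_comp X (assoKV Y Z W))) compm1.
rewrite (comp_rew2 (assoKV _ _ _)) compm1.
by rewrite whr_id_comp // assoKV.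
Qed.

(** This and the next three lemmas are the pentagon solved for other edges, in the forms that arise
    when rebracketed families are composed. *)
Lemma pentagon_inner X Y Z W :
  asso X (Y ⊗ Z) W ∘ asso X Y Z ▷ W ∘ assoV (X ⊗ Y) Z W
  = X ◁ assoV Y Z W ∘ asso X Y (Z ⊗ W).
Proof.
apply: (cancel_mono (whl_id_comp X (assoKV Y Z W))).
rewrite !compA -pentagon -!compA assoVK compm1 compA.
by rewrite whl_id_comp ?assoVK // comp1m.
Qed.

Lemma pentagonV_inner X Y Z W :
  asso (X ⊗ Y) Z W ∘ assoV X Y Z ▷ W ∘ assoV X (Y ⊗ Z) W
  = assoV X Y (Z ⊗ W) ∘ X ◁ asso Y Z W.
Proof.
apply: (cancel_mono (assoKV X Y (Z ⊗ W))).
rewrite !compA pentagon assoVK comp1m.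
have e := whr_id_comp W (assoVK X Y Z).
by rewrite (comp_rew2 e) compm1 -compA assoVK compm1.
Qed.

Lemma pentagon_last X Y Z W :
  X ◁ asso Y Z W ∘ asso X (Y ⊗ Z) W
  = asso X Y (Z ⊗ W) ∘ asso (X ⊗ Y) Z W ∘ assoV X Y Z ▷ W.
Proof.
rewrite pentagon; have e := whr_id_comp W (assoVK X Y Z).
by rewrite (comp_rew2 e) compm1.
Qed.

Lemma pentagonV_last X Y Z W :
  assoV X (Y ⊗ Z) W ∘ X ◁ assoV Y Z W
  = asso X Y Z ▷ W ∘ assoV (X ⊗ Y) Z W ∘ assoV X Y (Z ⊗ W).
Proof.
rewrite (comp_rew2 (pentagonV _ _ _ _)) !compA.
by rewrite whr_id_comp ?assoVK // comp1m.
Qed.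
End Tensor.

(** * Rebracketed dualities *)

(* The duality and braiding morphisms are tensored with an arbitrary object Z
   on the right and rebracketed to the right, so that diagrams of a strict
   category become chains of composable morphisms without associators.  They
   are locked to keep rewriting from unfolding them. *)
HB.lock Definition cap_at (K : fieldType) (C : tensor_category K) (A B : C)
    (f : hom (A ⊗ B) tunit) (Z : C) : hom (A ⊗ (B ⊗ Z)) Z :=
  lun Z ∘ f ▷ Z ∘ assoV A B Z.

HB.lock Definition cup_at (K : fieldType) (C : tensor_category K) (A B : C)
    (g : hom tunit (A ⊗ B)) (Z : C) : hom Z (A ⊗ (B ⊗ Z)) :=
  asso A B Z ∘ g ▷ Z ∘ lunV Z.

HB.lock Definition box_at (K : fieldType) (C : tensor_category K)
    (A B A' B' : C) (h : hom (A ⊗ B) (A' ⊗ B')) (Z : C) :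
    hom (A ⊗ (B ⊗ Z)) (A' ⊗ (B' ⊗ Z)) :=
  asso A' B' Z ∘ h ▷ Z ∘ assoV A B Z.

(** Here the bystander [M] stands on the left and brackets go to the left, as in the formulas of
    [chi_hat] and [chi_check]. *)
HB.lock Definition rcap (K : fieldType) (C : tensor_category K) (A B : C)
    (f : hom (A ⊗ B) tunit) (M : C) : hom (M ⊗ A ⊗ B) M :=
  run M ∘ M ◁ f ∘ asso M A B.

HB.lock Definition rcup (K : fieldType) (C : tensor_category K) (A B : C)
    (g : hom tunit (A ⊗ B)) (M : C) : hom M (M ⊗ A ⊗ B) :=
  assoV M A B ∘ M ◁ g ∘ runV M.

HB.lock Definition braid_at (K : fieldType) (C : ribbon_category K)
    (X Y Z : C) : hom (X ⊗ (Y ⊗ Z)) (Y ⊗ (X ⊗ Z)) :=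
  box_at (br X Y) Z.

Section Families.
Variables (K : fieldType) (C : tensor_category K).
Implicit Types X Y Z W A B : C.
Local Notation "𝟙" := (tunit : C).

Lemma cap_atE A B (f : hom (A ⊗ B) 𝟙) Z :
  cap_at f Z = lun Z ∘ f ▷ Z ∘ assoV A B Z.
Proof. by rewrite cap_at.unlock. Qed.

Lemma cup_atE A B (g : hom 𝟙 (A ⊗ B)) Z :
  cup_at g Z = asso A B Z ∘ g ▷ Z ∘ lunV Z.
Proof. by rewrite cup_at.unlock. Qed.

Lemma box_atE A B A' B' (h : hom (A ⊗ B) (A' ⊗ B')) Z :
  box_at h Z = asso A' B' Z ∘ h ▷ Z ∘ assoV A B Z.
Proof. by rewrite box_at.unlock. Qed.

Lemma cap_nat A B (f : hom (A ⊗ B) 𝟙) Z Z' (u : hom Z Z') :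
  cap_at f Z' ∘ A ◁ (B ◁ u) = u ∘ cap_at f Z.
Proof.
rewrite !cap_atE (comp_rew2 (assoV_nat _ _ _)) tmor_id !compA.
by rewrite (comp_rew2 (whr_whl _ _)) !compA lun_nat.
Qed.

Lemma cup_nat A B (g : hom 𝟙 (A ⊗ B)) Z Z' (u : hom Z Z') :
  A ◁ (B ◁ u) ∘ cup_at g Z = cup_at g Z' ∘ u.
Proof.
rewrite !cup_atE (comp_rew2 (lunV_nat _)) !compA -asso_nat tmor_id.
by rewrite (comp_rew2 (whr_whl _ _)) !compA.
Qed.

Lemma box_nat A B A' B' (h : hom (A ⊗ B) (A' ⊗ B')) Z Z' (u : hom Z Z') :
  box_at h Z' ∘ A ◁ (B ◁ u) = A' ◁ (B' ◁ u) ∘ box_at h Z.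
Proof.
rewrite !box_atE (comp_rew2 (assoV_nat _ _ _)) tmor_id !compA.
by rewrite (comp_rew2 (whr_whl _ _)) !compA -[idm (_ ⊗ _)]tmor_id asso_nat.
Qed.

Lemma cap_box A B A' B' (f : hom (A' ⊗ B') 𝟙) (h : hom (A ⊗ B) (A' ⊗ B')) Z :
  cap_at f Z ∘ box_at h Z = cap_at (f ∘ h) Z.
Proof.
rewrite !cap_atE !box_atE !compA (comp_rew2 (assoKV _ _ _)) compm1.
by rewrite whr_comp !compA.
Qed.

Lemma box_cup A B A' B' (g : hom 𝟙 (A ⊗ B)) (h : hom (A ⊗ B) (A' ⊗ B')) Z :
  box_at h Z ∘ cup_at g Z = cup_at (h ∘ g) Z.
Proof.
rewrite !cup_atE !box_atE !compA (comp_rew2 (assoKV _ _ _)) compm1.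
by rewrite whr_comp !compA.
Qed.

Lemma box_comp A B A' B' A'' B'' (h' : hom (A' ⊗ B') (A'' ⊗ B''))
    (h : hom (A ⊗ B) (A' ⊗ B')) Z :
  box_at (h' ∘ h) Z = box_at h' Z ∘ box_at h Z.
Proof.
by rewrite !box_atE !compA (comp_rew2 (assoKV _ _ _)) compm1 whr_comp !compA.
Qed.

Lemma box_tmor A B A' B' (s : hom A A') (t : hom B B') Z :
  box_at (s ⊗m t) Z = s ⊗m (t ▷ Z).
Proof. by rewrite !box_atE asso_nat -compA assoVK compm1. Qed.

Lemma cap_at_inj A B (f f' : hom (A ⊗ B) 𝟙) :
  cap_at f 𝟙 = cap_at f' 𝟙 -> f = f'.
Proof.
rewrite !cap_atE => e; apply: whr_unit_inj; apply: (cancel_mono (lunKV 𝟙)).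
exact: (cancel_epi (assoKV A B 𝟙)).
Qed.

(* A zigzag in C, tensored with Z, is the zigzag of the associated families. *)
Lemma whr_zigzag A B X (f : hom (A ⊗ B) 𝟙) (g : hom 𝟙 (X ⊗ A)) Z :
  (run X ∘ X ◁ f ∘ asso X A B ∘ g ▷ B ∘ lunV B) ▷ Z
  = X ◁ cap_at f Z ∘ cup_at g (B ⊗ Z).
Proof.
rewrite !cap_atE !cup_atE !whl_comp !whr_comp lunV_tensor !compA.
rewrite -[idm (B ⊗ Z)]tmor_id (comp_rew2 (esym (asso_nat _ _ _))) !compA.
rewrite (comp_rew2 (pentagon _ _ _ _)) !compA.
rewrite (comp_rew2 (whl_id_comp X (assoKV A B Z))) compm1.
by rewrite (comp_rew2 (esym (asso_nat _ _ _))) compA triangle.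
Qed.

Lemma whr_zagzig A B X (f : hom (A ⊗ B) 𝟙) (g : hom 𝟙 (B ⊗ X)) Z :
  (lun X ∘ f ▷ X ∘ assoV A B X ∘ A ◁ g ∘ runV A) ▷ Z
  = cap_at f (X ⊗ Z) ∘ A ◁ cup_at g Z.
Proof.
rewrite !cap_atE !cup_atE !whl_comp !whr_comp -lun_tensor -triangleV !compA.
rewrite (comp_rew2 (esym (assoV_nat _ _ _))) !compA.
rewrite (comp_rew2 (asso_nat _ _ _)) !compA.
by rewrite tmor_id (comp_rew3 (pentagonV_inner _ _ _ _)) !compA.
Qed.
End Families.

Section RightDuality.
Variables (K : fieldType) (C : tensor_category K).
Implicit Types X Y Z W A B M : C.
Local Notation "𝟙" := (tunit : C).

Lemma rcapE A B (f : hom (A ⊗ B) 𝟙) M :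
  rcap f M = run M ∘ M ◁ f ∘ asso M A B.
Proof. by rewrite rcap.unlock. Qed.

Lemma rcupE A B (g : hom 𝟙 (A ⊗ B)) M :
  rcup g M = assoV M A B ∘ M ◁ g ∘ runV M.
Proof. by rewrite rcup.unlock. Qed.

Lemma rcap_nat A B (f : hom (A ⊗ B) 𝟙) M M' (u : hom M M') :
  rcap f M' ∘ u ▷ A ▷ B = u ∘ rcap f M.
Proof.
rewrite !rcapE (comp_rew2 (asso_nat _ _ _)) tmor_id !compA.
by rewrite (comp_rew2 (esym (whr_whl _ _))) !compA run_nat.
Qed.

Lemma rcup_nat A B (g : hom 𝟙 (A ⊗ B)) M M' (u : hom M M') :
  u ▷ A ▷ B ∘ rcup g M = rcup g M' ∘ u.
Proof.
rewrite !rcupE (comp_rew2 (runV_nat _)) !compA -assoV_nat tmor_id.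
by rewrite (comp_rew2 (whr_whl _ _)) !compA.
Qed.

Lemma whl_zigzag A B X (f : hom (A ⊗ B) 𝟙) (g : hom 𝟙 (X ⊗ A)) M :
  M ◁ (run X ∘ X ◁ f ∘ asso X A B ∘ g ▷ B ∘ lunV B)
  = rcap f (M ⊗ X) ∘ rcup g M ▷ B.
Proof.
rewrite !rcapE !rcupE !whl_comp !whr_comp -run_tensor -triangleV !compA.
rewrite (comp_rew2 (esym (assoV_nat _ _ _))) !compA.
rewrite -[idm (M ⊗ X)]tmor_id (comp_rew2 (asso_nat _ _ _)) !compA.
rewrite (comp_rew2 (pentagon _ _ _ _)) !compA.
rewrite (comp_rew2 (whr_id_comp _ (assoVK M X A))) compm1.
by rewrite (comp_rew2 (assoVK _ _ _)) compm1.
Qed.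

Lemma whl_zagzig A B X (f : hom (A ⊗ B) 𝟙) (g : hom 𝟙 (B ⊗ X)) M :
  M ◁ (lun X ∘ f ▷ X ∘ assoV A B X ∘ A ◁ g ∘ runV A)
  = rcap f M ▷ X ∘ rcup g (M ⊗ A).
Proof.
rewrite !rcapE !rcupE !whl_comp !whr_comp -triangle runV_tensor !compA.
rewrite (comp_rew2 (asso_nat _ _ _)) !compA.
rewrite -[idm (M ⊗ A)]tmor_id (comp_rew2 (esym (assoV_nat _ _ _))) !compA.
rewrite (comp_rew2 (pentagonV _ _ _ _)) !compA.
rewrite (comp_rew2 (whr_id_comp _ (assoVK M A B))) compm1.
by rewrite (comp_rew2 (assoVK _ _ _)) compm1.
Qed.
End RightDuality.

(** * Sliding strands over crossings *)

Section Braiding.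
Variables (K : fieldType) (C : ribbon_category K).
Implicit Types X Y Z W A B : C.
Local Notation "𝟙" := (tunit : C).

Lemma braid_atE X Y Z : braid_at X Y Z = box_at (br X Y) Z.
Proof. by rewrite braid_at.unlock. Qed.

Lemma braid_nat X Y Z Z' (u : hom Z Z') :
  braid_at X Y Z' ∘ X ◁ (Y ◁ u) = Y ◁ (X ◁ u) ∘ braid_at X Y Z.
Proof. by rewrite !braid_atE box_nat. Qed.

Lemma braid_natl X X' Y Z (u : hom X X') :
  braid_at X' Y Z ∘ u ▷ (Y ⊗ Z) = Y ◁ (u ▷ Z) ∘ braid_at X Y Z.
Proof.
by rewrite !braid_atE -!tmor_id -!box_tmor -!box_comp br_nat.
Qed.

Lemma braid_natr X Y Y' Z (u : hom Y Y') :
  braid_at X Y' Z ∘ X ◁ (u ▷ Z) = u ▷ (X ⊗ Z) ∘ braid_at X Y Z.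
Proof.
by rewrite !braid_atE -!tmor_id -!box_tmor -!box_comp br_nat.
Qed.

(** The first hexagon tensored with [Z]; the pentagon removes the remaining associators. *)
Lemma braid_tensorr W A B Z :
  A ◁ braid_at W B Z ∘ braid_at W A (B ⊗ Z)
  = asso A B (W ⊗ Z) ∘ braid_at W (A ⊗ B) Z ∘ W ◁ assoV A B Z.
Proof.
rewrite !braid_atE !box_atE !whl_comp !compA.
rewrite [RHS](comp_rew2 (pentagonV_last _ _ _ _)) pentagon !compA.
have hex := congr1 (fun f => f ▷ Z) (hexagon1 W A B).
rewrite !whr_comp in hex; rewrite (comp_rew3 hex) !compA.
rewrite (comp_rew2 (asso_nat _ _ _)).
rewrite (comp_rew2 (esym (assoV_nat _ _ _))) !compA.
by rewrite tmor_id (comp_rew3 (pentagon_inner _ _ _ _)) !compA.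
Qed.

Lemma braid_tensorl W A B Z :
  braid_at A W (B ⊗ Z) ∘ A ◁ braid_at B W Z
  = W ◁ asso A B Z ∘ braid_at (A ⊗ B) W Z ∘ assoV A B (W ⊗ Z).
Proof.
rewrite !braid_atE !box_atE !whl_comp !compA.
rewrite pentagon_last [RHS](comp_rew2 (pentagonV _ _ _ _)) !compA.
have hex := congr1 (fun f => f ▷ Z) (hexagon2 A B W).
rewrite !whr_comp in hex; rewrite (comp_rew3 hex) !compA.
rewrite (comp_rew2 (asso_nat _ _ _)).
rewrite (comp_rew2 (esym (assoV_nat _ _ _))) !compA.
by rewrite tmor_id (comp_rew3 (pentagonV_inner _ _ _ _)) !compA.
Qed.

Lemma braid_at_inv X Y Z :
  inverse_pair (braid_at X Y Z) (box_at (brV X Y) Z).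
Proof.
have [e1 e2] := brK X Y.
rewrite braid_atE.
by split; rewrite -box_comp ?e1 ?e2 -tmor_id box_tmor !tmor_id.
Qed.

(** The hexagon for two copies of 𝟙 merges two crossings into one past 𝟙 ⊗ 𝟙, which naturality along
    [run 𝟙] turns into a single crossing; being invertible, it cancels. *)
Lemma braid_unitr W Z : lun (W ⊗ Z) ∘ braid_at W 𝟙 Z = W ◁ lun Z.
Proof.
have [_ inv] := braid_at_inv W 𝟙 (𝟙 ⊗ Z).
apply: whl_unit_inj; apply: (cancel_epi inv).
rewrite whl_comp (comp_rew2 (braid_tensorr _ _ _ _)) !compA.
rewrite triangle -lun_run_unit. rewrite -braid_natr.
rewrite -compA -whl_comp lun_run_unit -triangle -compA assoVK compm1.
exact: braid_nat.
Qed.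

Lemma braid_unitl W Z : W ◁ lun Z ∘ braid_at 𝟙 W Z = lun (W ⊗ Z).
Proof.
apply: whl_unit_inj; apply: (cancel_mono (proj1 (braid_at_inv 𝟙 W Z))).
rewrite whl_comp compA braid_nat (comp_rew2 (braid_tensorl _ _ _ _)) !compA.
rewrite -whl_comp triangle -braid_natl -triangle.
by rewrite -!compA assoVK compm1.
Qed.

Lemma braid_unitrV W Z : braid_at W 𝟙 Z ∘ W ◁ lunV Z = lunV (W ⊗ Z).
Proof.
apply: (cancel_mono (lunKV _)); rewrite compA braid_unitr lunVK.
by rewrite whl_id_comp // lunVK.
Qed.

Lemma braid_unitlV W Z : braid_at 𝟙 W Z ∘ lunV (W ⊗ Z) = W ◁ lunV Z.
Proof.
apply: (cancel_mono (whl_id_comp W (lunKV Z))).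
by rewrite compA braid_unitl lunVK whl_id_comp // lunVK.
Qed.

(** Crossing A and then B is crossing A ⊗ B, which is natural along [f], and crossing 𝟙 is trivial.
    The other slide lemmas have the same reason. *)
Lemma cap_slide_right A B (f : hom (A ⊗ B) 𝟙) W Z :
  cap_at f (W ⊗ Z) ∘ A ◁ braid_at W B Z ∘ braid_at W A (B ⊗ Z)
  = W ◁ cap_at f Z.
Proof.
rewrite (comp_rew2 (braid_tensorr _ _ _ _)) !cap_atE !compA.
rewrite (comp_rew2 (assoKV _ _ _)) compm1.
rewrite (comp_rew2 (esym (braid_natr _ _ _))) compA braid_unitr.
by rewrite !whl_comp.
Qed.

Lemma cap_slide_left A B (f : hom (A ⊗ B) 𝟙) W Z :
  W ◁ cap_at f Z ∘ braid_at A W (B ⊗ Z) ∘ A ◁ braid_at B W Z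
  = cap_at f (W ⊗ Z).
Proof.
rewrite (comp_rew2 (braid_tensorl _ _ _ _)) !cap_atE !whl_comp !compA.
rewrite (comp_rew2 (whl_id_comp W (assoKV A B Z))) compm1.
by rewrite (comp_rew2 (esym (braid_natl _ _ _))) compA braid_unitl.
Qed.

Lemma cup_slide_right A B (g : hom 𝟙 (A ⊗ B)) W Z :
  A ◁ braid_at W B Z ∘ braid_at W A (B ⊗ Z) ∘ W ◁ cup_at g Z
  = cup_at g (W ⊗ Z).
Proof.
rewrite braid_tensorr !cup_atE !whl_comp !compA.
rewrite (comp_rew2 (whl_id_comp W (assoKV A B Z))) compm1.
by rewrite (comp_rew2 (braid_natr _ _ _)) !compA (comp_rew2 (braid_unitrV _ _)).
Qed.

Lemma cup_slide_left A B (g : hom 𝟙 (A ⊗ B)) W Z :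
  braid_at A W (B ⊗ Z) ∘ A ◁ braid_at B W Z ∘ cup_at g (W ⊗ Z)
  = W ◁ cup_at g Z.
Proof.
rewrite braid_tensorl !cup_atE !whl_comp !compA.
rewrite (comp_rew2 (assoKV _ _ _)) compm1.
by rewrite (comp_rew2 (braid_natl _ _ _)) !compA (comp_rew2 (braid_unitlV _ _)).
Qed.

(** For [h] a braiding this is the Yang-Baxter relation, the case used in [loop_tensor]. *)
Lemma box_slide_left A B A' B' (h : hom (A ⊗ B) (A' ⊗ B')) W Z :
  braid_at A' W (B' ⊗ Z) ∘ A' ◁ braid_at B' W Z ∘ box_at h (W ⊗ Z)
  = W ◁ box_at h Z ∘ braid_at A W (B ⊗ Z) ∘ A ◁ braid_at B W Z.
Proof.
rewrite !braid_tensorl [RHS](comp_rew2 (braid_tensorl _ _ _ _)).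
rewrite !box_atE !whl_comp !compA.
rewrite (comp_rew2 (assoKV _ _ _)) compm1.
rewrite (comp_rew2 (whl_id_comp W (assoKV A B Z))) compm1.
by rewrite (comp_rew2 (braid_natl _ _ _)) !compA.
Qed.

Lemma box_at_inj A B A' B' (h h' : hom (A ⊗ B) (A' ⊗ B')) :
  box_at h 𝟙 = box_at h' 𝟙 -> h = h'.
Proof.
rewrite !box_atE => e; apply: whr_unit_inj.
apply: (cancel_mono (assoKV A' B' 𝟙)).
exact: (cancel_epi (assoKV A B 𝟙)).
Qed.

Lemma lun_unit_tensor X : lun (𝟙 ⊗ X) = 𝟙 ◁ lun X.
Proof. by apply: (cancel_mono (lunKV X)); rewrite lun_nat. Qed.

Lemma br_unit : br 𝟙 𝟙 = idm (𝟙 ⊗ 𝟙 : C).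
Proof.
apply: box_at_inj; rewrite -braid_atE -[in RHS]tmor_id box_tmor !tmor_id.
apply: (cancel_mono (lunKV _)).
by rewrite [LHS]braid_unitr compm1 lun_unit_tensor.
Qed.

(** Transporting [tw (𝟙 ⊗ 𝟙) = tw 𝟙 ⊗m tw 𝟙] along [lun 𝟙] shows that [tw 𝟙] is idempotent; it is
    also invertible. *)
Lemma tw_unit : tw 𝟙 = idm (𝟙 : C).
Proof.
have [inv _] := twK (𝟙 : C).
apply: (cancel_mono inv); rewrite compm1.
apply: (cancel_epi (lunVK 𝟙)).
rewrite [RHS]tw_nat tw_tensor br_unit !comp1m.
have e : (tw 𝟙 ⊗m tw 𝟙 : hom (𝟙 ⊗ 𝟙) (𝟙 ⊗ 𝟙)) = tw 𝟙 ▷ 𝟙 ∘ 𝟙 ◁ tw 𝟙.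
  by rewrite -tmor_comp comp1m compm1.
rewrite e compA lun_run_unit run_nat -lun_run_unit.
by rewrite (comp_rew2 (lun_nat _)) compA.
Qed.
End Braiding.

(** * Transposes, the second zigzag and closed loops *)

HB.lock Definition transpose_at (K : fieldType) (C : ribbon_category K)
    (P Q : C) (e : hom (Q ⊗ P) tunit) (Z : C) : hom (Q ⊗ Z) (dual P ⊗ Z) :=
  cap_at e (dual P ⊗ Z) ∘ Q ◁ cup_at (coev P) Z.

(** The quantum trace of [h] beside the bystander [Z]: a loop opened by [coev] and closed by
    [ev']. *)
HB.lock Definition loop_at (K : fieldType) (C : ribbon_category K) (X : C)
    (h : hom X X) (Z : C) : hom Z Z :=
  cap_at (ev X) Z ∘ braid_at X (dual X) Z ∘ (tw X ∘ h) ▷ (dual X ⊗ Z)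
  ∘ cup_at (coev X) Z.

Section Duality.
Variables (K : fieldType) (C : ribbon_category K).
Implicit Types X Y Z W A B : C.
Local Notation "𝟙" := (tunit : C).

Lemma zigzag_at X Z :
  X ◁ cap_at (ev X) Z ∘ cup_at (coev X) (X ⊗ Z) = idm (X ⊗ Z).
Proof. by rewrite -whr_zigzag zigzag tmor_id. Qed.

Lemma zagzig_at X Z :
  cap_at (ev X) (X^∨ ⊗ Z) ∘ X^∨ ◁ cup_at (coev X) Z = idm (X^∨ ⊗ Z).
Proof. by rewrite -whr_zagzig zagzig tmor_id. Qed.

Lemma cap_whr A A' B (f : hom (A' ⊗ B) 𝟙) (u : hom A A') Z :
  cap_at (f ∘ u ▷ B) Z = cap_at f Z ∘ u ▷ (B ⊗ Z).
Proof. by rewrite -cap_box box_tmor tmor_id. Qed.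

Lemma cap_whl A B B' (f : hom (A ⊗ B') 𝟙) (u : hom B B') Z :
  cap_at (f ∘ A ◁ u) Z = cap_at f Z ∘ A ◁ (u ▷ Z).
Proof. by rewrite -cap_box box_tmor. Qed.

Lemma cup_whr A A' B (g : hom 𝟙 (A ⊗ B)) (u : hom A A') Z :
  cup_at (u ▷ B ∘ g) Z = u ▷ (B ⊗ Z) ∘ cup_at g Z.
Proof. by rewrite -box_cup box_tmor tmor_id. Qed.

Lemma cup_whl A B B' (g : hom 𝟙 (A ⊗ B)) (u : hom B B') Z :
  cup_at (A ◁ u ∘ g) Z = A ◁ (u ▷ Z) ∘ cup_at g Z.
Proof. by rewrite -box_cup box_tmor. Qed.

Lemma cap_br A B (f : hom (B ⊗ A) 𝟙) Z :
  cap_at (f ∘ br A B) Z = cap_at f Z ∘ braid_at A B Z.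
Proof. by rewrite braid_atE cap_box. Qed.

Lemma cup_br A B (g : hom 𝟙 (A ⊗ B)) Z :
  cup_at (br A B ∘ g) Z = braid_at A B Z ∘ cup_at g Z.
Proof. by rewrite braid_atE box_cup. Qed.

Lemma twVK X : twV X ∘ tw X = idm X.
Proof. by case: (twK X). Qed.

(* Naturality of the twist at coev, where tw 𝟙 is trivial, replaces the braiding
   and twist in coev' by their inverses. *)
Lemma br_coev' X : br X^∨ X ∘ coev' X = twV X ▷ X^∨ ∘ coev X.
Proof.
have tw1 : X ◁ tw X^∨ ∘ coev X = tw X ▷ X^∨ ∘ coev X by rewrite tw_dual.
have inv := whr_id_comp X^∨ (twVK X).
have inv' : tw X ▷ X^∨ ∘ twV X ▷ X^∨ = idm _.
  by rewrite whr_id_comp //; case: (twK X).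
apply: (cancel_mono inv); rewrite [RHS]compA inv' comp1m.
rewrite -[RHS]compm1 -tw_unit -[RHS]tw_nat tw_tensor.
have -> : tw X ⊗m tw X^∨ = tw X ▷ X^∨ ∘ X ◁ tw X^∨.
  by rewrite -tmor_comp comp1m compm1.
rewrite -compA -[X in _ = _ ∘ X]compA tw1 /coev' !compA.
rewrite -br_nat (comp_rew2 (esym (br_nat _ _))) !compA; congr (_ ∘ _).
by rewrite (comp_rew2 (esym (br_nat _ _))) !compA.
Qed.

Lemma cap_ev' X Z : cap_at (ev' X) Z
  = cap_at (ev X) Z ∘ braid_at X X^∨ Z ∘ tw X ▷ (X^∨ ⊗ Z).
Proof. by rewrite /ev' cap_whr cap_br. Qed.

Lemma braid_cup_coev' X Z : braid_at X^∨ X Z ∘ cup_at (coev' X) Z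
  = twV X ▷ (X^∨ ⊗ Z) ∘ cup_at (coev X) Z.
Proof. by rewrite -cup_br br_coev' cup_whr. Qed.

(** Pull the cap over the strand X: one new crossing turns [coev'] into [coev] with an inverse
    twist, which cancels the twist of [ev']. The remaining crossings slide off [coev] and leave the
    plain zigzag. *)
Lemma zigzag'_at X Z :
  cap_at (ev' X) (X ⊗ Z) ∘ X ◁ cup_at (coev' X) Z = idm (X ⊗ Z).
Proof.
rewrite -cap_slide_left -compA -whl_comp braid_cup_coev' whl_comp !compA.
rewrite (comp_rew2 (braid_natr _ _ _)) !compA -whr_whl cap_ev' !whl_comp !compA.
rewrite (comp_rew2 (esym (braid_natl _ _ _))) !compA.
rewrite (comp_rew2 (whr_whl _ _)) !compA.
rewrite (comp_rew3 (cup_slide_right _ _ _)) (comp_rew2 (zigzag_at _ _)) compm1.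
by rewrite -whr_comp twVK tmor_id.
Qed.

Lemma zagzig'_at X Z :
  X^∨ ◁ cap_at (ev' X) Z ∘ cup_at (coev' X) (X^∨ ⊗ Z) = idm (X^∨ ⊗ Z).
Proof.
rewrite -cap_slide_right -compA braid_cup_coev' cap_ev' !compA.
rewrite (comp_rew2 (esym (whr_whl _ _))) !compA.
have inv : tw X ▷ (X^∨ ⊗ (X^∨ ⊗ Z)) ∘ twV X ▷ (X^∨ ⊗ (X^∨ ⊗ Z)) = idm _.
  by rewrite whr_id_comp //; case: (twK X).
rewrite (comp_rew2 inv) compm1.
by rewrite (comp_rew3 (cup_slide_left _ _ _)) zagzig_at.
Qed.

Section Transpose.
Variables (P Q : C) (e : hom (Q ⊗ P) 𝟙).

Local Notation transpose_at := (transpose_at e).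

Lemma cap_transpose Z : cap_at (ev P) Z ∘ transpose_at (P ⊗ Z) = cap_at e Z.
Proof.
rewrite transpose_at.unlock compA -cap_nat -compA -whl_comp zigzag_at.
by rewrite tmor_id compm1.
Qed.

Lemma braid_transpose W Z :
  braid_at W P^∨ Z ∘ W ◁ transpose_at Z = transpose_at (W ⊗ Z) ∘ braid_at W Q Z.
Proof.
rewrite transpose_at.unlock whl_comp -(cap_slide_right e) !compA -cap_nat.
rewrite (comp_rew2 (braid_nat _ _ _)) !compA; congr (_ ∘ _).
by rewrite -(cup_slide_right (coev P)) !whl_comp !compA.
Qed.

(** Serves two purposes: moving a morphism from one leg of [coev] to the other ([loop_cyclic]), and
    comparing [coev' X] with [coev X^∨] ([loop_dual]). *)
Lemma transpose_cup R (c : hom 𝟙 (R ⊗ Q)) (r : hom P R) :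
  (forall Z, R ◁ cap_at e Z ∘ cup_at c (P ⊗ Z) = r ▷ Z) ->
  forall Z, R ◁ transpose_at Z ∘ cup_at c Z
    = r ▷ (P^∨ ⊗ Z) ∘ cup_at (coev P) Z.
Proof.
move=> cP Z; rewrite transpose_at.unlock whl_comp.
by rewrite (comp_rew2 (cup_nat _ _)) !compA cP.
Qed.
End Transpose.

(** The transpose of [f] travels along the dual leg, through the crossing, to the cap, where it
    reappears as [f] on the other side of [g]; naturality carries it past the twist. *)
Lemma loop_cyclic X Y (f : hom X Y) (g : hom Y X) Z :
  loop_at (g ∘ f) Z = loop_at (f ∘ g) Z.
Proof.
pose phi := transpose_at (ev Y ∘ Y^∨ ◁ f).
have cupE : Y ◁ phi Z ∘ cup_at (coev Y) Z = f ▷ (X^∨ ⊗ Z) ∘ cup_at (coev X) Z.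
  apply: transpose_cup => Z'; rewrite cap_whl whl_comp.
  by rewrite (comp_rew2 (cup_nat _ _)) !compA zigzag_at comp1m.
rewrite loop_at.unlock !compA whr_comp !compA.
rewrite [LHS](comp_rew2 (esym cupE)) !compA.
rewrite (comp_rew2 (whr_whl _ _)) !compA.
rewrite (comp_rew2 (braid_transpose _ _ _)) !compA.
rewrite cap_transpose cap_whl (comp_rew2 (esym (braid_natl _ _ _))) !compA.
by rewrite -[X in X ∘ cup_at _ _]compA -whr_comp compA tw_nat.
Qed.

(** [transpose_at (ev' X)] is the pivotal map from X to its double dual. After it is slid from cup
    to cap, [tw_dual] moves the twist of X^∨ to X, where it cancels the inverse twist from
    [br_coev']. *)
Lemma loop_dual X Z : loop_at (idm X^∨) Z = loop_at (idm X) Z.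
Proof.
have cupE : X^∨ ◁ transpose_at (ev' X) Z ∘ cup_at (coev' X) Z
    = cup_at (coev X^∨) Z.
  rewrite (transpose_cup (r := idm X^∨)) ?tmor_id ?comp1m // => Z'.
  by rewrite zagzig'_at tmor_id.
rewrite loop_at.unlock !compm1 -cupE !compA (comp_rew2 (whr_whl _ _)) !compA.
rewrite (comp_rew2 (braid_transpose _ _ _)) !compA cap_transpose.
rewrite (comp_rew2 (braid_natl _ _ _)) !compA (comp_rew2 (braid_cup_coev' _ _)).
rewrite !compA (comp_rew2 (esym (whr_whl _ _))) !compA -compA -cup_whl -tw_dual.
rewrite cup_whr !compA (comp_rew2 (whr_id_comp _ (twVK X))) compm1.
by rewrite cap_ev'.
Qed.
End Duality.

(** * Loops labelled by a tensor product *)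

HB.lock Definition tensor_cup_at (K : fieldType) (C : ribbon_category K)
    (X Y Z : C) : hom Z (X ⊗ (Y ⊗ (dual (X ⊗ Y) ⊗ Z))) :=
  asso X Y (dual (X ⊗ Y) ⊗ Z) ∘ cup_at (coev (X ⊗ Y)) Z.

HB.lock Definition tensor_cap_at (K : fieldType) (C : ribbon_category K)
    (X Y Z : C) : hom (dual (X ⊗ Y) ⊗ (X ⊗ (Y ⊗ Z))) Z :=
  cap_at (ev (X ⊗ Y)) Z ∘ dual (X ⊗ Y) ◁ assoV X Y Z.

HB.lock Definition tensor_dual_at (K : fieldType) (C : ribbon_category K)
    (X Y Z : C) : hom (dual Y ⊗ (dual X ⊗ Z)) (dual (X ⊗ Y) ⊗ Z) :=
  cap_at (ev Y) (dual (X ⊗ Y) ⊗ Z)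
  ∘ dual Y ◁ (cap_at (ev X) (Y ⊗ (dual (X ⊗ Y) ⊗ Z))
              ∘ dual X ◁ tensor_cup_at X Y Z).

Section TensorDual.
Variables (K : fieldType) (C : ribbon_category K).
Implicit Types X Y Z W : C.

Lemma tensor_zigzag X Y Z :
  X ◁ (Y ◁ tensor_cap_at X Y Z) ∘ tensor_cup_at X Y (X ⊗ (Y ⊗ Z)) = idm _.
Proof.
rewrite tensor_cup_at.unlock tensor_cap_at.unlock !compA -asso_nat tmor_id.
rewrite whl_comp !compA (comp_rew2 (cup_nat _ _)) !compA.
by rewrite (comp_rew2 (zigzag_at _ _)) compm1 assoVK.
Qed.

Lemma tensor_cup_slide X Y W Z :
  X ◁ (Y ◁ braid_at W (X ⊗ Y)^∨ Z) ∘ X ◁ braid_at W Y ((X ⊗ Y)^∨ ⊗ Z)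
  ∘ braid_at W X (Y ⊗ ((X ⊗ Y)^∨ ⊗ Z)) ∘ W ◁ tensor_cup_at X Y Z
  = tensor_cup_at X Y (W ⊗ Z).
Proof.
rewrite tensor_cup_at.unlock whl_comp !compA.
rewrite (comp_rew2 (braid_tensorr _ _ _ _)) !compA.
rewrite (comp_rew2 (whl_id_comp W (assoKV _ _ _))) compm1.
rewrite -asso_nat tmor_id -!compA; congr (_ ∘ _); rewrite !compA.
exact: cup_slide_right.
Qed.

(* tensor_dual_at compares the nested duals Y^∨, X^∨ with (X ⊗ Y)^∨. *)
Lemma tensor_cupE X Y Z :
  X ◁ (Y ◁ tensor_dual_at X Y Z) ∘ X ◁ cup_at (coev Y) (X^∨ ⊗ Z)
  ∘ cup_at (coev X) Z = tensor_cup_at X Y Z.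
Proof.
rewrite -whl_comp tensor_dual_at.unlock (whl_comp Y) (comp_rew2 (cup_nat _ _)).
rewrite !compA zigzag_at comp1m (whl_comp X) (comp_rew2 (cup_nat _ _)) !compA.
by rewrite zigzag_at comp1m.
Qed.

Lemma tensor_capE X Y Z :
  tensor_cap_at X Y Z ∘ tensor_dual_at X Y (X ⊗ (Y ⊗ Z))
  = cap_at (ev Y) Z ∘ Y^∨ ◁ cap_at (ev X) (Y ⊗ Z).
Proof.
rewrite tensor_dual_at.unlock compA -cap_nat -compA -whl_comp compA -cap_nat.
by rewrite -compA -whl_comp tensor_zigzag tmor_id compm1.
Qed.

Lemma braid_tensor_dual X Y W Z :
  braid_at W (X ⊗ Y)^∨ Z ∘ W ◁ tensor_dual_at X Y Z
  = tensor_dual_at X Y (W ⊗ Z) ∘ Y^∨ ◁ braid_at W X^∨ Z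
    ∘ braid_at W Y^∨ (X^∨ ⊗ Z).
Proof.
rewrite tensor_dual_at.unlock (whl_comp W) -(cap_slide_right (ev Y)) !compA.
rewrite -cap_nat (comp_rew2 (braid_nat _ _ _)) !compA; congr (_ ∘ _).
rewrite -!compA -!whl_comp; congr (_ ∘ (_ ⊗m _)).
rewrite (whl_comp W) -(cap_slide_right (ev X)) !compA -cap_nat.
rewrite (comp_rew2 (braid_nat _ _ _)) !compA; congr (_ ∘ _).
rewrite -!compA -!whl_comp; congr (_ ∘ (_ ⊗m _)).
by rewrite -tensor_cup_slide !whl_comp !compA.
Qed.

(* After replacing (X ⊗ Y)^∨ by the nested duals, the Yang-Baxter relation pulls
   the double crossing of tw (X ⊗ Y) through them, where it cancels. *)
Lemma loop_tensor X Y Z :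
  loop_at (idm (X ⊗ Y)) Z
  = cap_at (ev' X) Z ∘ X ◁ loop_at (idm Y) (X^∨ ⊗ Z) ∘ cup_at (coev X) Z.
Proof.
rewrite !loop_at.unlock !compm1.
have -> : cap_at (ev (X ⊗ Y)) Z ∘ braid_at (X ⊗ Y) (X ⊗ Y)^∨ Z
    = tensor_cap_at X Y Z ∘ braid_at X (X ⊗ Y)^∨ (Y ⊗ Z)
      ∘ X ◁ braid_at Y (X ⊗ Y)^∨ Z ∘ asso X Y ((X ⊗ Y)^∨ ⊗ Z).
  rewrite (comp_rew2 (braid_tensorl _ _ _ _)) tensor_cap_at.unlock !compA.
  rewrite (comp_rew2 (whl_id_comp _ (assoKV _ _ _))) compm1.
  by rewrite (comp_rew2 (assoKV _ _ _)) compm1.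
have -> : cup_at (coev (X ⊗ Y)) Z
    = assoV X Y ((X ⊗ Y)^∨ ⊗ Z) ∘ tensor_cup_at X Y Z.
  by rewrite tensor_cup_at.unlock compA assoKV comp1m.
rewrite -tensor_cupE !compA.
have box3 : forall V, asso X Y V ∘ tw (X ⊗ Y) ▷ V ∘ assoV X Y V
  = box_at (tw (X ⊗ Y)) V by move=> V; rewrite box_atE.
rewrite (comp_rew3 (box3 _)) (comp_rew2 (box_nat _ _)) !compA.
rewrite (comp_rew2 (esym (whl_comp X (braid_at Y (X ⊗ Y)^∨ Z) _))).
rewrite braid_tensor_dual !(whl_comp X) !compA.
rewrite (comp_rew2 (braid_tensor_dual _ _ _ _)) !compA tensor_capE.
rewrite (comp_rew2 (braid_nat _ _ _)) tw_tensor !box_comp box_tmor.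
rewrite -!braid_atE !compA.
have yb W V : braid_at X W (Y ⊗ V) ∘ X ◁ braid_at Y W V ∘ braid_at Y X (W ⊗ V)
    = W ◁ braid_at Y X V ∘ braid_at Y W (X ⊗ V) ∘ Y ◁ braid_at X W V.
  by rewrite (braid_atE Y X) box_slide_left -braid_atE.
rewrite (comp_rew3 (yb _ _)) !compA.
(* The strand Y slides off the cap of X, which uses up one of the two crossings in [tw_tensor]. *)
have slide : cap_at (ev X) (Y ⊗ Z) ∘ braid_at X X^∨ (Y ⊗ Z)
    ∘ X ◁ braid_at Y X^∨ Z ∘ braid_at Y X (X^∨ ⊗ Z) = Y ◁ (cap_at (ev X) Z ∘ braid_at X X^∨ Z).
  by rewrite (comp_rew3 (yb _ _)) !compA cap_slide_right -whl_comp.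
have {}slide := congr1 (fun f => Y^∨ ◁ f) slide.
rewrite !(whl_comp Y^∨) in slide.
rewrite -3![in LHS](compA (cap_at (ev Y) Z)) slide cap_nat.
rewrite !(comp_rew2 (esym (cap_br (ev Y) _))).
(* The strand X likewise slides off the cap of Y and absorbs the other crossing. *)
rewrite (comp_rew3 (cap_slide_right _ _ _)) cap_ev'.
have -> : tw X ⊗m (tw Y ▷ (Y^∨ ⊗ (X^∨ ⊗ Z)))
    = tw X ▷ _ ∘ X ◁ (tw Y ▷ (Y^∨ ⊗ (X^∨ ⊗ Z))).
  by rewrite -tmor_comp comp1m compm1.
by rewrite !compA (comp_rew2 (esym (whr_whl _ _))) cap_br (whl_comp X) !compA.
Qed.
End TensorDual.

(** * Simple objects and dimensions *)

Section Schur.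
Variables (K : fieldType) (L : linear_category K) (A : abelian L).
Implicit Types X Y Z U : L.

Lemma id_neq0 U : simple U -> idm U != 0.
Proof.
case=> nz _; apply/eqP => e; apply: nz => Y; split=> f.
  by rewrite -[f]compm1 e compm0.
by rewrite -[f]comp1m e comp0m.
Qed.

Lemma schur U V (f : hom U V) : simple U -> simple V -> f != 0 -> iso f.
Proof.
move=> [nzU sU] [_ sV] nzf; have [Z [k [fk kerP]]] := has_kernel A f.
have mono_k : mono k.
  move=> W g h e; have e0 : f ∘ (k ∘ g) = 0 by rewrite compA fk comp0m.
  have [h' [_ uniq_h']] := kerP _ _ e0.
  by rewrite -(uniq_h' g) // (uniq_h' h).
case: (sU _ _ mono_k) => [zZ|[k' [_ kk']]]; last first.
  by case/eqP: nzf; rewrite -[f]compm1 -kk' compA fk comp0m.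
have mono_f : mono f.
  move=> W g h e; have e0 : f ∘ (g - h) = 0 by rewrite compmD compmN e subrr.
  have [h' [e' _]] := kerP _ _ e0.
  by apply/eqP; rewrite -subr_eq0 -e' ((zZ W).2 h') compm0.
by case: (sV _ _ mono_f).
Qed.

Lemma dual_bases_coord V U (D : dual_bases V U) (f : hom V U) a :
  f ∘ tnth (db_dual D) a = coord (db D) a f *: idm U.
Proof.
rewrite {1}(coord_basis (db_basis D) (memvf f)) comp_suml (bigD1 a) //=.
rewrite big1 ?addr0 => [|c ca]; rewrite -tnth_nth compZm db_pairing.
  by rewrite eqxx.
by rewrite (negbTE ca) scaler0.
Qed.

Lemma dual_bases_expand V U (D : dual_bases V U) (f : hom V U) :
  \sum_a (f ∘ tnth (db_dual D) a ∘ tnth (db D) a) = f.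
Proof.
rewrite [RHS](coord_basis (db_basis D) (memvf f)); apply: eq_bigr => a _.
by rewrite dual_bases_coord compZm comp1m -tnth_nth.
Qed.

(* Two distinct basis vectors x, y of End(U) with dual x', y' cannot exist:
   y' is invertible by Schur's lemma and x ∘ y' = 0. *)
Lemma end_simple U (D : dual_bases U U) (f : hom U U) :
  simple U -> exists c, f = c *: idm U.
Proof.
move=> sU; have nz := id_neq0 sU.
have all_eq a c : a = c :> 'I_(db_size D).
  apply/eqP/negPn/negP => ac; have e := db_pairing a c.
  rewrite (negbTE ac) in e.
  have [|g [gd dg]] := @schur _ _ (tnth (db_dual D) c) sU sU.
    apply: contraNneq nz => d0.
    by have := db_pairing c c; rewrite eqxx d0 compm0 => <-.
  have b0 : tnth (db D) a = 0 by rewrite -[LHS]compm1 -dg compA e comp0m.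
  have := db_pairing a (d := D) a; rewrite eqxx b0 comp0m => /esym/eqP.
  by rewrite (negbTE nz).
have [a|no_a] := pickP (fun _ : 'I_(db_size D) => true); last first.
  exists 0; rewrite -(dual_bases_expand D f) scale0r big1 // => a.
  by have := no_a a.
move=> _; have single (g : hom U U) : g = coord (db D) a g *: tnth (db D) a.
  rewrite {1}(coord_basis (db_basis D) (memvf g)) (big_pred1 a) -?tnth_nth //.
  by move=> c; rewrite /= (all_eq c a) eqxx.
have nzc : coord (db D) a (idm U) != 0.
  by apply: contraNneq nz => c0; rewrite (single (idm U)) c0 scale0r.
exists (coord (db D) a f / coord (db D) a (idm U)).
by rewrite [X in _ = _ *: X]single scalerA divfK // -single.
Qed.
End Schur.

(** * Resolution of the identity by dual bases *)

Section Fusion.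
Variables (K : fieldType) (C : modular_category K).
Variable b : forall (V : C) (i : simple_index C), dual_bases V (simple_ob i).
Implicit Types (V W X Y Z : C) (i j : simple_index C).
Local Notation "𝟙" := (tunit : C).

Lemma simple_ob_simple i : simple (simple_ob i).
Proof. exact: srep_simple. Qed.

Lemma hom_simple_neq i j (f : hom (simple_ob i) (simple_ob j)) :
  i != j -> f = 0.
Proof.
move=> ij; apply/eqP; apply: contraNT ij => nzf; apply/eqP.
apply: (srep_irredundant (s := mc_simples C)); exists f.
by apply: (schur (mc_abelian C)) nzf; apply: simple_ob_simple.
Qed.

Lemma end_scalar i (f : hom (simple_ob i) (simple_ob i)) :
  exists c, f = c *: idm _.
Proof.
exact: (end_simple (mc_abelian C) (b _ i) f (simple_ob_simple i)).
Qed.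

(** The sum [E] satisfies q ∘ E = q for every q into a simple object, and V is a direct sum of
    simples, so that such q jointly detect equality of morphisms into V. *)
Lemma completeness V :
  \sum_i \sum_a tnth (db_dual (b V i)) a ∘ tnth (db (b V i)) a = idm V.
Proof.
set E := \sum_i _.
have fixU j (q : hom V (simple_ob j)) : q ∘ E = q.
  rewrite comp_sumr (bigD1 j) //= [X in _ + X]big1 ?addr0 => [|i ij].
    rewrite comp_sumr; under eq_bigr do rewrite compA.
    exact: dual_bases_expand.
  rewrite comp_sumr big1 // => a _.
  by rewrite compA (hom_simple_neq (q ∘ _)) // comp0m.
have [I [S [simS [g [g' [g'g _]]]]]] := mc_semisimple V.
have fixS k (q : hom V (S k)) : q ∘ E = q.
  have [j [h [h' [h'h _]]]] := srep_complete (mc_simples C) (simS k).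
  apply: (cancel_mono h'h); rewrite compA; exact: (@fixU j).
apply: (cancel_mono g'g); rewrite compm1 -[g]comp1m -sum_inj_proj.
rewrite !comp_suml; apply: eq_bigr => k _.
by rewrite -!compA [proj _ _ ∘ (_ ∘ _)]compA fixS.
Qed.

Lemma unit_index : exists j, isomorphic 𝟙 (simple_ob j).
Proof. exact: srep_complete (mc_unit_simple C). Qed.

Lemma scalar_ofE (f : hom 𝟙 𝟙) : f = scalar_of f *: idm 𝟙.
Proof.
have nz := id_neq0 (mc_unit_simple C).
have [c ->] : exists c, f = c *: idm 𝟙.
  have [j [h [h' [h'h hh']]]] := unit_index.
  have [c e] := end_scalar (h ∘ f ∘ h'); exists c.
  have -> : f = h' ∘ (h ∘ f ∘ h') ∘ h.
    by rewrite !compA h'h comp1m -compA h'h compm1.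
  by rewrite e compmZ compm1 compZm h'h.
have free1 : free [tuple idm 𝟙] by rewrite /= seq1_free.
rewrite /scalar_of linearZ /=.
have /= -> := coord_free ord0 ord0 free1.
by rewrite mulr1.
Qed.

Lemma dim_hom_to V i : \dim {: hom V (simple_ob i)} = db_size (b V i).
Proof. exact: size_basis (db_basis (b V i)). Qed.

(** The dual vectors form a basis as well: [completeness] makes them span, and the pairing makes
    them free. *)
Lemma dim_hom_from V i : \dim {: hom (simple_ob i) V} = db_size (b V i).
Proof.
set D := b V i.
have nz := id_neq0 (simple_ob_simple i).
suff B : basis_of {:hom (simple_ob i) V} (db_dual D).
  exact: size_basis B.
have span g : g \in <<db_dual D>>%VS.
  rewrite -[g]comp1m -(completeness V) comp_suml (bigD1 i) //=.
  rewrite [X in _ + X]big1 => [|j ji].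
    rewrite addr0 comp_suml; apply: memv_suml => a _; rewrite -compA.
    have [c ->] := end_scalar (tnth (db D) a ∘ g).
    by rewrite compmZ compm1 memvZ // memv_span // mem_tnth.
  rewrite comp_suml; apply: big1 => a _.
  by rewrite -compA (hom_simple_neq (tnth _ _ ∘ g)) ?compm0 // eq_sym.
apply/andP; split.
  by apply/eqP/vspaceP => g; rewrite memvf span.
apply/freeP => k k0 a; have := congr1 (fun g => tnth (db D) a ∘ g) k0.
rewrite comp_sumr compm0 (bigD1 a) //= big1 ?addr0 => [|c ca].
  rewrite -tnth_nth compmZ db_pairing eqxx => /eqP.
  by rewrite scaler_eq0 (negbTE nz) orbF => /eqP.
by rewrite -tnth_nth compmZ db_pairing eq_sym (negbTE ca) scaler0.
Qed.
End Fusion.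

(** * Quantum dimensions and fusion multiplicities *)

Section Dimensions.
Variables (K : fieldType) (C : modular_category K).
Variable b : forall (V : C) (i : simple_index C), dual_bases V (simple_ob i).
Implicit Types (V W X Y Z : C) (i j k : simple_index C).
Local Notation "𝟙" := (tunit : C).

(** Naturality of the braiding moves the twist through the crossing, so [ev' X ∘ coev X] agrees with
    the [ev X ∘ coev' X] of [qdim]. *)
Lemma loop_id X Z : loop_at (idm X) Z = qdim X *: idm Z.
Proof.
rewrite loop_at.unlock compm1 -cap_ev' cap_atE cup_atE !compA.
rewrite (comp_rew2 (assoKV _ _ _)) compm1 (comp_rew2 (esym (whr_comp _ _ _))).
have -> : ev' X ∘ coev X = ev X ∘ coev' X.
  by rewrite /ev' /coev' !compA (comp_rew2 (br_nat _ _)) !compA.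
rewrite (scalar_ofE b (ev X ∘ coev' X)) tmorZl tmor_id compmZ compm1 compZm.
by rewrite lunVK.
Qed.

Lemma loop_sum (I : finType) X (h : I -> hom X X) Z :
  loop_at (\sum_i h i) Z = \sum_i loop_at (h i) Z.
Proof.
rewrite loop_at.unlock comp_sumr.
rewrite (bilinear_suml _ _ (tmor_bilinear _ _ _ _)) comp_sumr.
exact: comp_suml.
Qed.

Lemma id_scale_inj (c c' : K) : c *: idm 𝟙 = c' *: idm 𝟙 -> c = c'.
Proof.
move/eqP; rewrite -subr_eq0 -scalerBl scaler_eq0.
by rewrite (negbTE (id_neq0 (mc_unit_simple C))) orbF subr_eq0 => /eqP.
Qed.

(** Resolve [idm V] by [completeness]; cyclicity turns each dual pair into the identity of U_i. *)
Lemma qdim_sum V :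
  qdim V = \sum_i (db_size (b V i))%:R * qdim (simple_ob i).
Proof.
apply: id_scale_inj; rewrite -loop_id -(completeness b V) loop_sum scaler_suml.
apply: eq_bigr => i _; rewrite loop_sum.
under eq_bigr => a _ do rewrite loop_cyclic db_pairing eqxx loop_id.
by rewrite sumr_const card_ord mulr_natl scalerMnl.
Qed.

Lemma qdim_tensor X Y : qdim (X ⊗ Y) = qdim X * qdim Y.
Proof.
apply: id_scale_inj; rewrite -loop_id loop_tensor loop_id tmorZr tmor_id.
rewrite compmZ compm1 compZm mulrC -scalerA; congr (_ *: _).
by rewrite -loop_id loop_at.unlock compm1 cap_ev'.
Qed.

Lemma qdim_dual X : qdim X^∨ = qdim X.
Proof. by apply: id_scale_inj; rewrite -!loop_id loop_dual. Qed.

(* Every f : U^∨ ⊗ U -> 𝟙 is a multiple of ev, since Hom(U^∨ ⊗ U, 𝟙) is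
   isomorphic to End(U); some such f does not vanish on coev'. *)
Lemma qdim_neq0 i : qdim (simple_ob i) != 0.
Proof.
set U := simple_ob i; have nz1 := id_neq0 (mc_unit_simple C).
have capE (f : hom (U^∨ ⊗ U) 𝟙) : exists c, f = c *: ev U.
  pose h := run U ∘ U ◁ f ∘ asso U U^∨ U ∘ coev U ▷ U ∘ lunV U.
  have [c hc] := end_scalar b (h : hom U U); exists c.
  apply: cap_at_inj; rewrite -[LHS]compm1 -(zagzig_at U (U ⊗ 𝟙)) compA.
  rewrite -cap_nat -compA -whl_comp -whr_zigzag -/h hc !cap_atE !tmorZl !tmorZr.
  by rewrite !tmor_id !compmZ compZm compm1.
apply/eqP => q0; have evcoev : ev U ∘ coev' U = 0.
  by rewrite (scalar_ofE b (ev U ∘ coev' U)) -/(qdim U) q0 scale0r.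
have coev0 : coev' U = 0.
  rewrite -[LHS]comp1m -(completeness b) comp_suml big1 // => k _.
  rewrite comp_suml big1 // => a _; rewrite -compA.
  suff -> : tnth (db (b (U^∨ ⊗ U) k)) a ∘ coev' U = 0 by rewrite compm0.
  apply/eqP/negPn/negP => nz.
  have [g [gK _]] :=
    schur (mc_abelian C) (mc_unit_simple C) (simple_ob_simple k) nz.
  have [c cE] := capE (g ∘ tnth (db (b (U^∨ ⊗ U) k)) a).
  rewrite compA cE compZm evcoev scaler0 in gK.
  by rewrite -gK eqxx in nz1.
have nzU := id_neq0 (simple_ob_simple i).
case/eqP: nzU; apply: whr_unit_inj; rewrite tmor0l tmor_id.
rewrite -(zigzag'_at U 𝟙) coev0.
by rewrite cup_atE tmor0l compm0 comp0m tmor0r compm0.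
Qed.

Lemma dim_hom_le (V W : vectType K) (f : V -> W) (g : W -> V) :
  linear f -> cancel f g -> (\dim {:V} <= \dim {:W})%N.
Proof.
move=> lin_f fK; pose fL := GRing.isLinear.Build K V W *:%R f lin_f.
pose F : {linear V -> W} := HB.pack f fL.
have ker0 : lker (linfun F) == 0%VS.
  by apply/lker0P => x y; rewrite !lfunE /= => /(can_inj fK).
rewrite -(limg_dim_eq (U := fullv) (f := linfun F)) ?dimvS ?subvf //.
by rewrite (eqP ker0) capv0.
Qed.

Lemma dim_hom_dual X Y Z :
  \dim {: hom (X^∨ ⊗ Y) Z} = \dim {: hom Y (X ⊗ Z)}.
Proof.
pose f (h : hom (X^∨ ⊗ Y) Z) : hom Y (X ⊗ Z) := X ◁ h ∘ cup_at (coev X) Y.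
pose g (h : hom Y (X ⊗ Z)) : hom (X^∨ ⊗ Y) Z := cap_at (ev X) Z ∘ X^∨ ◁ h.
have lin_f : linear f.
  move=> c h h'; rewrite /f (tmor_bilinear _ _ _ _).1.
  exact: (comp_bilinear _ _ _).2.
have lin_g : linear g.
  move=> c h h'; rewrite /g (tmor_bilinear _ _ _ _).1.
  exact: (comp_bilinear _ _ _).1.
have fK : cancel f g.
  by move=> h; rewrite /g /f whl_comp compA cap_nat -compA zagzig_at compm1.
have gK : cancel g f.
  by move=> h; rewrite /g /f whl_comp -compA cup_nat compA zigzag_at comp1m.
by apply/eqP; rewrite eqn_leq (dim_hom_le lin_f fK) (dim_hom_le lin_g gK).
Qed.

(** Duality identifies Hom(X^∨ ⊗ U_k, U_j) with Hom(U_k, X ⊗ U_j), which by semisimplicity has the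
    dimension of Hom(X ⊗ U_j, U_k). *)
Lemma fusion_dual X j k :
  db_size (b (X^∨ ⊗ simple_ob k) j) = db_size (b (X ⊗ simple_ob j) k).
Proof. by rewrite -dim_hom_to dim_hom_dual -(dim_hom_from b). Qed.
End Dimensions.

(* Pair the eigenvector d of N, and of its transpose, with its conjugate. *)
Lemma eigenvalue_conj (F : numClosedFieldType) (I : finType) (d : I -> F)
    (N : I -> I -> nat) (x y : F) (i0 : I) :
  d i0 != 0 ->
  (forall j, x * d j = \sum_k (N j k)%:R * d k) ->
  (forall k, y * d k = \sum_j (N j k)%:R * d j) ->
  x = y^*.
Proof.
move=> d0 xE yE; set n := \sum_j `|d j| ^+ 2.
have n0 : n != 0.
  apply/eqP => /psumr_eq0P n0.
  have /eqP := n0 (fun j _ => exprn_ge0 2 (normr_ge0 (d j))) i0 isT.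
  by rewrite expf_eq0 /= normr_eq0 (negbTE d0).
apply: (mulIf n0).
(* Summed over k for fixed j, [xE] produces x; summed over j for fixed k, [yE] produces the
   conjugate of y, since the entries of [N] are real. *)
transitivity (\sum_j \sum_k (N j k)%:R * (d k * (d j)^*)).
  rewrite mulr_sumr; apply: eq_bigr => j _.
  rewrite normCK mulrA xE mulr_suml; apply: eq_bigr => k _.
  by rewrite mulrA.
rewrite exchange_big /= mulr_sumr; apply: eq_bigr => k _.
rewrite normCK [d k * _]mulrC mulrA -rmorphM yE rmorph_sum mulr_suml.
apply: eq_bigr => j _ /=; rewrite rmorphM /= conjC_nat.
by rewrite -mulrA [_^* * _]mulrC.
Qed.

Lemma total_dim_neq0 (F : numClosedFieldType) (C : modular_category F)
    (b : forall (V : C) (i : simple_index C), dual_bases V (simple_ob i)) :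
  total_dim C != 0.
Proof.
have [i0 _] := unit_index C.
have conj_qdim (i : simple_index C) :
    qdim (simple_ob i) = (qdim (simple_ob i))^*.
  (* Now x is the dimension of U_i and y that of its dual. *)
  rewrite -{2}qdim_dual //.
  apply: (@eigenvalue_conj _ _ (fun j => qdim (simple_ob j))
    (fun j k => db_size (b (simple_ob i ⊗ simple_ob j) k)) _ _ i0).
  - exact: qdim_neq0.
  - by move=> j; rewrite -qdim_tensor // (qdim_sum b).
  move=> k; rewrite -qdim_tensor // (qdim_sum b).
  by apply: eq_bigr => j _; rewrite fusion_dual.
have sq (i : simple_index C) :
    qdim (simple_ob i) ^+ 2 = `|qdim (simple_ob i)| ^+ 2.
  by rewrite normCK -conj_qdim.
rewrite /total_dim; apply/eqP; under eq_bigr do rewrite sq.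
move=> /psumr_eq0P n0.
have /eqP := n0 (fun j _ => exprn_ge0 2 (normr_ge0 _)) i0 isT.
by rewrite expf_eq0 /= normr_eq0 (negbTE (qdim_neq0 b i0)).
Qed.

(** * The adjunctions *)

(** Naturality is tested on [psi], since the inverse maps below involve no choice of bases. *)
Lemma adjunction_of_inverse (C1 C2 : category) (F : functor C1 C2)
    (G : functor C2 C1)
    (chi : forall (X : C1) (Y : C2), mor (F X) Y -> mor X (G Y))
    (psi : forall (X : C1) (Y : C2), mor X (G Y) -> mor (F X) Y) :
  (forall X Y, cancel (@chi X Y) (@psi X Y)) ->
  (forall X Y, cancel (@psi X Y) (@chi X Y)) ->
  (forall X X' Y Y' (h : mor X' X) (k : mor Y Y') (t : mor X (G Y)),
     psi X' Y' (cat_comp (fmap G k) (cat_comp t h))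
     = cat_comp k (cat_comp (psi X Y t) (fmap F h))) ->
  is_adjunction chi.
Proof.
move=> chiK psiK nat; split=> [X Y|X X' Y Y' h k f].
  by exists (psi X Y); [exact: chiK | exact: psiK].
by rewrite -{1}(chiK _ _ f) -nat psiK.
Qed.

(** * Currying along both dualities *)

Section Currying.
Variables (K : fieldType) (C : ribbon_category K).
Implicit Types X Y M A U V W : C.

Definition curry M U A (h : hom (M ⊗ U) A) : hom M (A ⊗ U^∨) :=
  h ▷ U^∨ ∘ rcup (coev U) M.

Definition uncurry M U A (k : hom M (A ⊗ U^∨)) : hom (M ⊗ U) A :=
  rcap (ev U) A ∘ k ▷ U.

Definition curry' A M U (h : hom A (M ⊗ U)) : hom (A ⊗ U^∨) M :=
  rcap (ev' U) M ∘ h ▷ U^∨.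

Definition uncurry' A M U (k : hom (A ⊗ U^∨) M) : hom A (M ⊗ U) :=
  k ▷ U ∘ rcup (coev' U) A.

Lemma curryK M U A : cancel (@curry M U A) (@uncurry M U A).
Proof.
move=> h; rewrite /uncurry /curry whr_comp compA rcap_nat -compA -whl_zigzag.
by rewrite zigzag tmor_id compm1.
Qed.

Lemma uncurryK M U A : cancel (@uncurry M U A) (@curry M U A).
Proof.
move=> k; rewrite /uncurry /curry whr_comp -compA rcup_nat compA -whl_zagzig.
by rewrite zagzig tmor_id comp1m.
Qed.

Lemma zigzag' U :
  lun U ∘ ev' U ▷ U ∘ assoV U U^∨ U ∘ U ◁ coev' U ∘ runV U = idm U.
Proof. by apply: whr_unit_inj; rewrite whr_zagzig zigzag'_at tmor_id. Qed.

Lemma zagzig' U :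
  run U^∨ ∘ U^∨ ◁ ev' U ∘ asso U^∨ U U^∨ ∘ coev' U ▷ U^∨ ∘ lunV U^∨
  = idm U^∨.
Proof. by apply: whr_unit_inj; rewrite whr_zigzag zagzig'_at tmor_id. Qed.

Lemma curry'K A M U : cancel (@curry' A M U) (@uncurry' A M U).
Proof.
move=> h; rewrite /uncurry' /curry' whr_comp -compA rcup_nat compA -whl_zagzig.
by rewrite zigzag' tmor_id comp1m.
Qed.

Lemma uncurry'K A M U : cancel (@uncurry' A M U) (@curry' A M U).
Proof.
move=> k; rewrite /uncurry' /curry' whr_comp compA rcap_nat -compA -whl_zigzag.
by rewrite zagzig' tmor_id compm1.
Qed.

Lemma uncurry_comp M M' U A A' (u : hom M' M) (v : hom A A')
    (k : hom M (A ⊗ U^∨)) :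
  uncurry (v ▷ U^∨ ∘ k ∘ u) = v ∘ uncurry k ∘ u ▷ U.
Proof. by rewrite /uncurry !whr_comp !compA rcap_nat. Qed.

Lemma uncurry'_comp A A' M M' U (u : hom A' A) (v : hom M M')
    (k : hom (A ⊗ U^∨) M) :
  uncurry' (v ∘ k ∘ u ▷ U^∨) = v ▷ U ∘ uncurry' k ∘ u.
Proof. by rewrite /uncurry' !whr_comp -!compA rcup_nat. Qed.

Lemma uncurry_linear M U A : linear (@uncurry M U A).
Proof.
move=> c k k'; rewrite /uncurry (tmor_bilinear _ _ _ _).2.
exact: (comp_bilinear _ _ _).1.
Qed.

Lemma curry_linear M U A : linear (@curry M U A).
Proof.
move=> c k k'; rewrite /curry (tmor_bilinear _ _ _ _).2.
exact: (comp_bilinear _ _ _).2.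
Qed.

Lemma uncurry'_linear A M U : linear (@uncurry' A M U).
Proof.
move=> c k k'; rewrite /uncurry' (tmor_bilinear _ _ _ _).2.
exact: (comp_bilinear _ _ _).2.
Qed.

Lemma curry'_linear A M U : linear (@curry' A M U).
Proof.
move=> c k k'; rewrite /curry' (tmor_bilinear _ _ _ _).2.
exact: (comp_bilinear _ _ _).1.
Qed.
End Currying.

(** * Components of the inverse maps *)

Section Lifts.
Variables (K : fieldType) (C : modular_category K).
Implicit Types X Y M A U V W : C.

(** On a pure tensor, [g] takes the right-hand factor [W] to U, and [ev U] then contracts U with the
    dual strand produced by [k]. *)
Definition lift_hat V W A U (t : tens (hom V (A ⊗ U^∨)) (hom W U)) :
    hom (V ⊗ W) A :=
  tens_lift (fun k g => uncurry k ∘ V ◁ g) t.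

Definition lift_check A U V W (t : tens (hom (A ⊗ U^∨) V) (hom U W)) :
    hom A (V ⊗ W) :=
  tens_lift (fun k g => V ◁ g ∘ uncurry' k) t.

Lemma lift_hat_linear V W A U : linear (@lift_hat V W A U).
Proof. exact: tens_lift_linear. Qed.

Lemma lift_check_linear V W A U : linear (@lift_check V W A U).
Proof. exact: tens_lift_linear. Qed.

Lemma lift_hat_pure V W A U (k : hom V (A ⊗ U^∨)) (g : hom W U) :
  lift_hat (tens_pure k g) = uncurry k ∘ V ◁ g.
Proof.
apply: tens_lift_pure; split=> [{}k c g' g''|{}g c k' k''].
  by rewrite (tmor_bilinear _ _ _ _).1 (comp_bilinear _ _ _).1.
by rewrite uncurry_linear (comp_bilinear _ _ _).2.
Qed.

Lemma lift_check_pure V W A U (k : hom (A ⊗ U^∨) V) (g : hom U W) :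
  lift_check (tens_pure k g) = V ◁ g ∘ uncurry' k.
Proof.
apply: tens_lift_pure; split=> [{}k c g' g''|{}g c k' k''].
  by rewrite (tmor_bilinear _ _ _ _).1 (comp_bilinear _ _ _).2.
by rewrite uncurry'_linear (comp_bilinear _ _ _).1.
Qed.

Lemma pair_tmor_linear V W V' W' : linear (@pair_tmor K C V W V' W').
Proof. exact: tens_lift_linear. Qed.

Lemma lift_hat_comp V V' W W' A A' U (s : @pair_hom K C (mirror C) V' W' V W)
    (v : hom A A') (t : @pair_hom K C (mirror C) V W (A ⊗ U^∨) U) :
  lift_hat (pair_comp (tens_pure (v ▷ U^∨) (idm U)) (pair_comp t s))
  = v ∘ (lift_hat t ∘ pair_tmor s).
Proof.
have B := @pair_comp_bilinear K C (mirror C).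
move: t; apply: tens_ind => [a t t' Pt Pt'|k g].
  rewrite (B _ _ _ _ _ _).2 (B _ _ _ _ _ _).1 !lift_hat_linear Pt Pt'.
  by rewrite (comp_bilinear _ _ _).2 (comp_bilinear _ _ _).1.
move: s; apply: tens_ind => [a s s' Ps Ps'|k' g'].
  rewrite !(B _ _ _ _ _ _).1 lift_hat_linear Ps Ps' pair_tmor_linear.
  by rewrite !(comp_bilinear _ _ _).1.
rewrite !pair_comp_pure !lift_hat_pure pair_tmor_pure compA uncurry_comp.
rewrite comp1m whl_comp.
have -> : k' ⊗m g' = k' ▷ W ∘ V' ◁ g' by rewrite -tmor_comp comp1m compm1.
by rewrite !compA (comp_rew2 (esym (whr_whl _ _))) !compA.
Qed.

Lemma lift_check_comp V V' W W' A A' U (s : @pair_hom K C (mirror C) V W V' W')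
    (u : hom A' A) (t : @pair_hom K C (mirror C) (A ⊗ U^∨) U V W) :
  lift_check (pair_comp s (pair_comp t (tens_pure (u ▷ U^∨) (idm U))))
  = pair_tmor s ∘ (lift_check t ∘ u).
Proof.
have B := @pair_comp_bilinear K C (mirror C).
move: t; apply: tens_ind => [a t t' Pt Pt'|k g].
  rewrite (B _ _ _ _ _ _).2 (B _ _ _ _ _ _).1 !lift_check_linear Pt Pt'.
  by rewrite (comp_bilinear _ _ _).2 (comp_bilinear _ _ _).1.
move: s; apply: tens_ind => [a s s' Ps Ps'|k' g'].
  rewrite !(B _ _ _ _ _ _).2 lift_check_linear Ps Ps' pair_tmor_linear.
  by rewrite !(comp_bilinear _ _ _).2.
rewrite !pair_comp_pure !lift_check_pure pair_tmor_pure (compA k' k).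
rewrite uncurry'_comp.
rewrite (compm1 g) whl_comp.
have -> : k' ⊗m g' = V' ◁ g' ∘ k' ▷ W by rewrite -tmor_comp comp1m compm1.
by rewrite !compA (comp_rew2 (whr_whl _ _)) !compA.
Qed.
End Lifts.

Lemma linear_sum (K : fieldType) (V W : lmodType K) (f : V -> W) (I : finType)
    (x : I -> V) :
  linear f -> f (\sum_i x i) = \sum_i f (x i).
Proof.
move=> lin_f; pose fL := GRing.isLinear.Build K V W *:%R f lin_f.
pose F : {linear V -> W} := HB.pack f fL.
exact: (raddf_sum F).
Qed.

Lemma linear_scale (K : fieldType) (V W : lmodType K) (f : V -> W) c x :
  linear f -> f (c *: x) = c *: f x.
Proof.
move=> lin_f; pose fL := GRing.isLinear.Build K V W *:%R f lin_f.
pose F : {linear V -> W} := HB.pack f fL.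
exact: (linearZ_LR F).
Qed.

Section DirectSum.
Variables (K : fieldType) (L : linear_category K) (I : finType) (X : I -> L).
Variable D : direct_sum X.

Lemma copair_inj Y (h : forall n, hom (X n) Y) m :
  (\sum_n h n ∘ proj D n) ∘ inj D m = h m.
Proof.
rewrite comp_suml (bigD1 m) //= big1 ?addr0 => [|n nm].
  by rewrite -compA proj_inj compm1.
by rewrite -compA proj_inj0 1?eq_sym // compm0.
Qed.

Lemma proj_pair Y (h : forall n, hom Y (X n)) m :
  proj D m ∘ (\sum_n inj D n ∘ h n) = h m.
Proof.
rewrite comp_sumr (bigD1 m) //= big1 ?addr0 => [|n nm].
  by rewrite compA proj_inj comp1m.
by rewrite compA proj_inj0 // comp0m.
Qed.
End DirectSum.

(** * The bijections and their naturality *)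

Section Adjunctions.
Variables (K : fieldType) (C : modular_category K).
Variable b : forall (V : C) (i : simple_index C), dual_bases V (simple_ob i).
Implicit Types (A V W : C) (M N : C2 C) (i j : simple_index C).

(** Naturality of the associator absorbs it into [rcup], so each term is a curried morphism. *)
Lemma chi_hatE M A (f : hom (T_ob M) A) n i :
  chi_hat b f n i = \sum_a tens_pure
    (curry (f ∘ inj (T_sum M) n
            ∘ fs_l n ◁ tnth (db_dual (b (fs_r n) i)) a))
    (tnth (db (b (fs_r n) i)) a).
Proof.
apply: eq_bigr => a _; congr tens_pure.
rewrite /curry rcupE (comp_rew2 (assoV_nat _ _ _)) !whr_comp.
by rewrite !compA.
Qed.

Lemma chi_checkE A M (g : hom A (T_ob M)) i n :
  chi_check b g i n = \sum_a (total_dim C / qdim (simple_ob i)) *: tens_pure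
    (curry' (fs_l n ◁ tnth (db (b (fs_r n) i)) a ∘ (proj (T_sum M) n ∘ g)))
    (tnth (db_dual (b (fs_r n) i)) a).
Proof.
apply: eq_bigr => a _; congr (_ *: tens_pure _ _).
by rewrite /curry' rcapE !whr_comp !compA (comp_rew2 (asso_nat _ _ _)) !compA.
Qed.

Definition chi_hat_inv M A (t : mor M (R_ob A)) : hom (T_ob M) A :=
  \sum_n (\sum_i lift_hat (t n i)) ∘ proj (T_sum M) n.

(** The scalar is the reciprocal of the factor in [chi_check]. *)
Definition chi_check_inv A M (t : mor (R_ob A) M) : hom A (T_ob M) :=
  \sum_n inj (T_sum M) n
    ∘ \sum_i (qdim (simple_ob i) / total_dim C) *: lift_check (t i n).

Lemma chi_hatK M A : cancel (@chi_hat K C b M A) (@chi_hat_inv M A).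
Proof.
move=> f; rewrite /chi_hat_inv -[RHS]compm1 -(sum_inj_proj (T_sum M)).
rewrite comp_sumr; apply: eq_bigr => n _; rewrite compA; congr (_ ∘ _).
rewrite -[RHS]compm1 -tmor_id -(completeness b (fs_r n)) tmor_sumr comp_sumr.
apply: eq_bigr => i _; rewrite chi_hatE.
rewrite (linear_sum _ (@lift_hat_linear _ _ _ _ _ _)).
rewrite tmor_sumr comp_sumr; apply: eq_bigr => a _.
by rewrite lift_hat_pure curryK whl_comp !compA.
Qed.

Lemma lift_hat_dual V W A i j
    (t : tens (hom V (A ⊗ (simple_ob j)^∨)) (hom W (simple_ob j))) a :
  i != j -> lift_hat t ∘ V ◁ tnth (db_dual (b W i)) a = 0.
Proof.
move=> ij; move: t; apply: tens_ind => [c t t' Pt Pt'|k g].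
  by rewrite lift_hat_linear (comp_bilinear _ _ _).2 Pt Pt' scaler0 addr0.
rewrite lift_hat_pure -compA -whl_comp (hom_simple_neq (g ∘ _)) //.
by rewrite tmor0r compm0.
Qed.

(** For t = k × g, pairing [g] with the dual basis yields its coordinates; these scalars move across
    the tensor sign and reassemble [g]. *)
Lemma lift_hat_expand V W A i
    (t : tens (hom V (A ⊗ (simple_ob i)^∨)) (hom W (simple_ob i))) :
  \sum_a tens_pure (curry (lift_hat t ∘ V ◁ tnth (db_dual (b W i)) a))
    (tnth (db (b W i)) a) = t.
Proof.
move: t; apply: tens_ind => [c t t' Pt Pt'|k g].
  rewrite -{2}Pt -{2}Pt' scaler_sumr -big_split; apply: eq_bigr => a _ /=.
  rewrite lift_hat_linear (comp_bilinear _ _ _).2 curry_linear.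
  exact: (tens_pure_bilinear _ _).2.
rewrite -{2}(dual_bases_expand (b W i) g).
rewrite (bilinear_sumr _ _ (tens_pure_bilinear _ _)); apply: eq_bigr => a _.
rewrite lift_hat_pure -compA -whl_comp dual_bases_coord compZm comp1m.
rewrite (bilinear_Zr _ _ _ (tens_pure_bilinear _ _)).
rewrite -(bilinear_Zl _ _ _ (tens_pure_bilinear _ _)); congr tens_pure.
rewrite tmorZr tmor_id compmZ compm1.
by rewrite (linear_scale _ _ (@curry_linear _ _ _ _ _)) uncurryK.
Qed.

Lemma chi_hat_invK M A : cancel (@chi_hat_inv M A) (@chi_hat K C b M A).
Proof.
move=> t; apply: fs_ext => n i; rewrite chi_hatE.
rewrite /chi_hat_inv (copair_inj (T_sum M)) -[RHS](lift_hat_expand (t n i)).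
apply: eq_bigr => a _; congr (tens_pure (curry _) _).
rewrite comp_suml (bigD1 i) //= big1 ?addr0 // => j ji.
by rewrite lift_hat_dual // eq_sym.
Qed.

Lemma chi_checkK A M : total_dim C != 0 ->
  cancel (@chi_check K C b A M) (@chi_check_inv A M).
Proof.
move=> dim_neq0 g; rewrite /chi_check_inv.
rewrite -[RHS]comp1m -(sum_inj_proj (T_sum M)).
rewrite comp_suml; apply: eq_bigr => n _; rewrite -compA; congr (_ ∘ _).
rewrite -[RHS]comp1m -tmor_id -(completeness b (fs_r n)) tmor_sumr comp_suml.
apply: eq_bigr => i _; rewrite chi_checkE.
rewrite (linear_sum _ (@lift_check_linear _ _ _ _ _ _)) scaler_sumr.
rewrite tmor_sumr comp_suml; apply: eq_bigr => a _.
rewrite (linear_scale _ _ (@lift_check_linear _ _ _ _ _ _)) scalerA.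
(* The two normalizations multiply to 1 because Dim C and dim U_i are nonzero. *)
rewrite mulrA divfK // divff ?qdim_neq0 // scale1r.
by rewrite lift_check_pure curry'K whl_comp !compA.
Qed.

Lemma lift_check_dual V W A i j
    (t : tens (hom (A ⊗ (simple_ob j)^∨) V) (hom (simple_ob j) W)) a :
  i != j -> V ◁ tnth (db (b W i)) a ∘ lift_check t = 0.
Proof.
move=> ij; move: t; apply: tens_ind => [c t t' Pt Pt'|k g].
  by rewrite lift_check_linear (comp_bilinear _ _ _).1 Pt Pt' scaler0 addr0.
rewrite lift_check_pure compA -whl_comp (hom_simple_neq (_ ∘ g)) 1?eq_sym //.
by rewrite tmor0r comp0m.
Qed.

Lemma lift_check_expand V W A i
    (t : tens (hom (A ⊗ (simple_ob i)^∨) V) (hom (simple_ob i) W)) :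
  \sum_a tens_pure (curry' (V ◁ tnth (db (b W i)) a ∘ lift_check t))
    (tnth (db_dual (b W i)) a) = t.
Proof.
move: t; apply: tens_ind => [c t t' Pt Pt'|k g].
  rewrite -{2}Pt -{2}Pt' scaler_sumr -big_split; apply: eq_bigr => a _ /=.
  rewrite lift_check_linear (comp_bilinear _ _ _).1 curry'_linear.
  exact: (tens_pure_bilinear _ _).2.
(* By [completeness], where Schur's lemma kills the terms of index other than i. *)
have {2}-> : g = \sum_a tnth (db_dual (b W i)) a ∘ (tnth (db (b W i)) a ∘ g).
  rewrite -[LHS]comp1m -(completeness b) comp_suml (bigD1 i) //= comp_suml.
  rewrite [X in _ + X]big1 ?addr0 => [|j ji].
    by apply: eq_bigr => a _; rewrite compA.
  rewrite comp_suml big1 // => a _.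
  rewrite -compA (hom_simple_neq (_ ∘ g)) ?compm0 //.
  by rewrite eq_sym.
rewrite (bilinear_sumr _ _ (tens_pure_bilinear _ _)); apply: eq_bigr => a _.
rewrite lift_check_pure compA -whl_comp.
have [c ->] := end_scalar b (tnth (db (b W i)) a ∘ g); rewrite compmZ compm1.
rewrite (bilinear_Zr _ _ _ (tens_pure_bilinear _ _)).
rewrite -(bilinear_Zl _ _ _ (tens_pure_bilinear _ _)); congr tens_pure.
rewrite tmorZr tmor_id compZm comp1m.
by rewrite (linear_scale _ _ (@curry'_linear _ _ _ _ _)) uncurry'K.
Qed.

Lemma chi_check_invK A M : total_dim C != 0 ->
  cancel (@chi_check_inv A M) (@chi_check K C b A M).
Proof.
move=> dim_neq0 t; apply: fs_ext => i n; rewrite chi_checkE.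
rewrite /chi_check_inv (proj_pair (T_sum M)) -[RHS](lift_check_expand (t i n)).
apply: eq_bigr => a _; rewrite -(bilinear_Zl _ _ _ (tens_pure_bilinear _ _)).
congr tens_pure; rewrite comp_sumr (bigD1 i) //= big1 ?addr0 => [|j ji].
  rewrite compmZ (linear_scale _ _ (@curry'_linear _ _ _ _ _)) scalerA.
  by rewrite mulrA divfK ?qdim_neq0 // divff // scale1r.
by rewrite compmZ lift_check_dual ?scaler0 // eq_sym.
Qed.

Lemma comp_R_mor A A' M (k : hom A A') (s : mor M (R_ob A)) m i :
  fs_comp (R_mor k) s m i = pair_comp (R_mor k i i) (s m i).
Proof.
rewrite /fs_comp (bigD1 i) //= big1 ?addr0 // => j ji.
rewrite /R_mor dfwith_out //.
exact/bilinear_0l/pair_comp_bilinear.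
Qed.

Lemma R_mor_comp_at A A' M (k : hom A' A) (s : mor (R_ob A) M) i m :
  fs_comp s (R_mor k) i m = pair_comp (s i m) (R_mor k i i).
Proof.
rewrite /fs_comp (bigD1 i) //= big1 ?addr0 // => j ji.
rewrite /R_mor [dfwith _ _ j]dfwith_out 1?eq_sym //.
exact/bilinear_0r/pair_comp_bilinear.
Qed.

Lemma chi_hat_inv_natural M M' A A' (h : mor M' M) (k : hom A A')
    (t : mor M (R_ob A)) :
  chi_hat_inv (cat_comp (R_mor k : mor (R_ob A) (R_ob A')) (cat_comp t h))
  = k ∘ (chi_hat_inv t ∘ T_mor h).
Proof.
rewrite /T_mor !comp_sumr; apply: eq_bigr => m _.
rewrite !comp_sumr; under [RHS]eq_bigr => n _.
  rewrite !compA -[k ∘ _ ∘ inj _ n]compA copair_inj; over.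
rewrite /= -comp_suml; congr (_ ∘ _).
under [LHS]eq_bigr => i _.
  rewrite comp_R_mor /R_mor dfwith_in /= /fs_comp.
  rewrite (bilinear_sumr _ _ (pair_comp_bilinear _ _ _ _ _ _)).
  rewrite (linear_sum _ (@lift_hat_linear _ _ _ _ _ _)).
  under eq_bigr => n _ do rewrite lift_hat_comp.
  over.
rewrite exchange_big /=; apply: eq_bigr => n _.
by rewrite -compA comp_suml comp_sumr.
Qed.

(** The scalars depend on i alone and [R_mor h] preserves i, so they factor out of
    [lift_check_comp]. *)
Lemma chi_check_inv_natural A A' M M' (h : hom A' A) (k : mor M M')
    (t : mor (R_ob A) M) :
  chi_check_inv (cat_comp k (cat_comp t (R_mor h : mor (R_ob A') (R_ob A))))
  = T_mor k ∘ (chi_check_inv t ∘ h).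
Proof.
rewrite /T_mor exchange_big /= comp_suml; apply: eq_bigr => n _.
rewrite comp_suml; under [RHS]eq_bigr => m _.
  rewrite -!compA (compA (proj _ _)) proj_pair; over.
rewrite /= -comp_sumr; congr (_ ∘ _).
under [LHS]eq_bigr => i _.
  rewrite [fs_comp k _ _ _]/fs_comp.
  rewrite (linear_sum _ (@lift_check_linear _ _ _ _ _ _)) scaler_sumr.
  under eq_bigr => m _ do
    rewrite R_mor_comp_at /R_mor dfwith_in lift_check_comp.
  over.
rewrite exchange_big /=; apply: eq_bigr => m _.
rewrite [X in _ ∘ X]comp_suml comp_sumr.
by apply: eq_bigr => i _; rewrite compZm compmZ.
Qed.
End Adjunctions.

Theorem theorem2p21 (RR : realType) (C : modular_category (RR[i])%type)
    (b : forall (V : C) (i : simple_index C), dual_bases V (simple_ob i)) :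
  @is_adjunction (C2 C) (cat_of C) (functor_T C) (functor_R C)
    (fun M A => @chi_hat (RR[i])%type C b M A) /\
  exists chi_check_inv :
      forall (A : C) (M : C2 C),
        mor (functor_R C A) M -> @mor (cat_of C) A (functor_T C M),
    (forall (A : C) (M : C2 C),
        cancel (@chi_check (RR[i])%type C b A M) (chi_check_inv A M) /\
        cancel (chi_check_inv A M) (@chi_check (RR[i])%type C b A M)) /\
    @is_adjunction (cat_of C) (C2 C) (functor_R C) (functor_T C) chi_check_inv.
Proof.
have dim_neq0 : total_dim C != 0 by apply: total_dim_neq0 b.
split.
  apply: (@adjunction_of_inverse (C2 C) (cat_of C) (functor_T C) (functor_R C)
    (fun M A => @chi_hat _ C b M A) (fun M A => @chi_hat_inv _ C M A)).
  - exact: chi_hatK.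
  - exact: chi_hat_invK.
  by move=> *; apply: chi_hat_inv_natural.
exists (@chi_check_inv _ C); split=> [A M|].
  by split; [apply: chi_checkK | apply: chi_check_invK].
(* The adjunction map is [chi_check_inv] itself, with [chi_check] as its inverse. *)
split=> [A M|A A' M M' h k t]; last exact: chi_check_inv_natural.
by exists (@chi_check _ C b A M); [apply: chi_check_invK | apply: chi_checkK].
Qed.
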